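(* Let $n\ge 3$, let $\beta=\{\beta_{ij}\}_{i,j\in\mathbb{Z}_+,\,i+j\le 2n}$ be a real bivariate sequence, and let $p(x,y)=y^2-x^3-ax-b$ with $a,b\in\mathbb{R}$. Assume that the moment matrix $M(n)$ of $\beta$ is positive semidefinite and $p$-pure. Let $R(\theta)$ be the quadratic polynomial (i.e. polynomial of degree at most $2$) associated with $\beta$ as in the context. Then the following statements are equivalent: (1) $\beta$ admits a $(\operatorname{rank}M(n))$-atomic $\mathcal{Z}(p)$-representing measure. (2) $M(n)$ admits a flat extension $M(n+1)$. (3) The quadratic polynomial $R(\theta)$ has a real root. Moreover, suppose that $R(\theta)=R_2\theta^2+R_1\theta+R_0\in\mathbb{R}[\theta]$ is nonzero and has a real root, and set $\Delta:=R_1^2-4R_0R_2$. Then: (1) If $\Delta=0$, there is a unique $(\operatorname{rank}M(n))$-atomic $\mathcal{Z}(p)$-representing measure for $\beta$. (2) If $\Delta>0$, there are exactly two $(\operatorname{rank}M(n))$-atomic $\mathcal{Z}(p)$-representing measures for $\beta$.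
   Context: $\mathcal{Z}(p)=\{(x,y)\in\mathbb{R}^2: p(x,y)=0\}$. A $\mathcal{Z}(p)$-representing measure for $\beta$ is a positive Borel measure $\mu$ on $\mathbb{R}^2$ with $\operatorname{supp}(\mu)\subseteq\mathcal{Z}(p)$ and $\beta_{ij}=\int x^iy^j\,d\mu$ for all $i,j\ge0$, $i+j\le 2n$; it is $r$-atomic if its support consists of exactly $r$ points. Moment matrix: $M(n)$ is the real symmetric matrix with rows and columns indexed by the monomials $x^iy^j$, $i+j\le n$ (degree-lexicographic order; columns denoted $X^iY^j$), whose entry in row $x^iy^j$ and column $x^ky^l$ is $\beta_{i+k,j+l}$. For $q=\sum a_{ij}x^iy^j$ with $\deg q\le n$ put $q(X,Y)=\sum a_{ij}X^iY^j$; $q$ is a column relation of $M(n)$ if $q(X,Y)=0$. $M(n)$ is $p$-pure if its column relations are exactly those obtained from $p$ by linearity and recursiveness, i.e. exactly the polynomials $pr$ with $r\in\mathbb{R}[x,y]$, $\deg(pr)\le n$. A flat extension $M(n+1)$ of $M(n)$ is a positive semidefinite moment matrix $M(n+1)$ of a sequence $\{\beta_{ij}\}_{i+j\le 2n+2}$ extending $\beta$ such that $\operatorname{rank}M(n+1)=\operatorname{rank}M(n)$. For $p=y^2-x^3-ax-b$, $p$-purity gives $\operatorname{rank}M(n)=3n$, and the columns indexed by $$\mathcal{B}=\{1,X,Y\}\cup\bigcup_{k=2}^{n}\{X^2Y^{k-2},\,XY^{k-1},\,Y^k\}$$ form a basis of the column space. $[M(n)]_{\mathcal{B}}$ denotes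 the $3n\times 3n$ principal submatrix of $M(n)$ with rows and columns indexed by $\mathcal{B}$; it is invertible. Degree $2n+1$ moments: define, for $i=0,\dots,2n-2$, $$\beta_{i+3,\,2n-i-2}:=\beta_{i,\,2n-i}-a\,\beta_{i+1,\,2n-i-2}-b\,\beta_{i,\,2n-i-2},$$ and let the remaining three be real variables $\theta:=\beta_{2,2n-1}$, $\phi:=\beta_{1,2n}$, $\psi:=\beta_{0,2n+1}$. For $i+j=n+1$ let $[X^iY^j]_{\mathcal{B}}:=(\beta_{i+k,\,j+l})_{X^kY^l\in\mathcal{B}}$, a vector of length $3n$. In the rows $X^2Y^{n-2},XY^{n-1},Y^n$ the vector $[X^2Y^{n-1}]_{\mathcal{B}}$ has entries $\beta_{4,2n-3},\beta_{3,2n-2},\theta$; $[XY^n]_{\mathcal{B}}$ has entries $\beta_{3,2n-2},\theta,\phi$; $[Y^{n+1}]_{\mathcal{B}}$ has entries $\theta,\phi,\psi$; all other entries are determined by $\beta$. Define $$\phi_*(\theta):=[X^2Y^{n-1}]_{\mathcal{B}}^{t}[M(n)]_{\mathcal{B}}^{-1}[X^2Y^{n-1}]_{\mathcal{B}}+a\,\beta_{2,2n-2}+b\,\beta_{1,2n-2},$$ $$\psi_*(\theta,\phi):=[XY^{n}]_{\mathcal{B}}^{t}[M(n)]_{\mathcal{B}}^{-1}[X^2Y^{n-1}]_{\mathcal{B}}+a\,\beta_{1,2n-1}+b\,\beta_{0,2n-1},$$ $$Q(\theta,\phi,\psi):=[Y^{n+1}]_{\mathcal{B}}^{t}[M(n)]_{\mathcal{B}}^{-1}[X^2Y^{n-1}]_{\mathcal{B}}-[XY^{n}]_{\mathcal{B}}^{t}[M(n)]_{\mathcal{B}}^{-1}[XY^{n}]_{\mathcal{B}},$$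 and $$R(\theta):=Q\bigl(\theta,\phi_*(\theta),\psi_*(\theta,\phi_*(\theta))\bigr).$$
   Formalization: In the last clause (Δ>0 gives exactly two measures) the formal statement also assumes R_2≠0; if R_2=0 and R_1≠0 then Δ=R_1²>0 but R has a single root and there is exactly one measure, so the clause as written is false there. *)

(* Defs.v *)
From mathcomp Require Import all_boot all_order all_algebra.
From mathcomp Require Import all_classical all_reals all_analysis.
Import Order.TTheory GRing.Theory Num.Theory numFieldNormedType.Exports.

Set Implicit Arguments.
Unset Strict Implicit.
Unset Printing Implicit Defensive.

Local Open Scope classical_set_scope.
Local Open Scope ring_scope.

(* Bivariate polynomials are [{poly {poly R}}] as in polyXY: ['X] is the outer
   variable, ['Y = 'X%:P] the inner one, so the coefficient of x^i y^j in [q]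
   is [q`_i`_j]. *)

Definition total_degree_le (R : realType) (d : nat) (q : {poly {poly R}}) : Prop :=
  forall i j, q`_i`_j != 0 -> (i + j <= d)%N.

Definition cubic (R : realType) (a b : R) : {poly {poly R}} :=
  'Y ^+ 2 - 'X ^+ 3 - a%:P%:P * 'X - b%:P%:P.

Definition zero_locus (R : realType) (p : {poly {poly R}}) : set (R * R) :=
  [set z | p.[z.1, z.2] = 0].

(* The Borel sigma-algebra of the plane is the product sigma-algebra carried by
   [R * R]. *)
Definition plane_measure (R : realType) := {measure set (R * R) -> \bar R}.

Definition msupp (R : realType) (mu : plane_measure R) : set (R * R) :=
  [set z | forall U : set (R * R), open U -> U z -> (0 < mu U)%E].

(* A measure is a function on all sets, constrained on measurable ones only:
   equality of measures has to be tested on the latter. *)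
Definition same_measure (R : realType) (mu nu : plane_measure R) : Prop :=
  forall A, measurable A -> mu A = nu A.

(* A sequence (beta_ij) with i + j <= 2n is a total function of which only the
   entries of degree at most 2n are used. *)
Definition representing_measure (R : realType) (p : {poly {poly R}}) (n : nat)
    (beta : nat -> nat -> R) (mu : plane_measure R) : Prop :=
  msupp mu `<=` zero_locus p /\
  forall i j, (i + j <= 2 * n)%N ->
    mu.-integrable setT (fun z : R * R => (z.1 ^+ i * z.2 ^+ j)%:E) /\
    (\int[mu]_z (z.1 ^+ i * z.2 ^+ j)%:E = (beta i j)%:E)%E.

Definition atomic_representing_measure (R : realType) (r : nat)
    (p : {poly {poly R}}) (n : nat) (beta : nat -> nat -> R)
    (mu : plane_measure R) : Prop :=
  representing_measure p n beta mu /\ (msupp mu #= `I_r)%card.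

(* The monomial x^i y^j is encoded by the pair (i, j). *)

Definition monomials (n : nat) : seq (nat * nat) :=
  flatten [seq [seq ((d - j)%N, j) | j <- iota 0 d.+1] | d <- iota 0 n.+1].

Definition basisB (n : nat) : seq (nat * nat) :=
  [:: (0, 0); (1, 0); (0, 1)]%N ++
  flatten [seq [:: (2, k - 2); (1, k - 1); (0, k)]%N | k <- iota 2 n.-1].

Definition mon (s : seq (nat * nat)) (k : 'I_(size s)) : nat * nat :=
  nth (0, 0)%N s k.

Definition moment_mx_on (R : realType) (s : seq (nat * nat))
    (beta : nat -> nat -> R) : 'M[R]_(size s) :=
  \matrix_(k, l) beta ((mon k).1 + (mon l).1)%N ((mon k).2 + (mon l).2)%N.

Definition moment_mx (R : realType) (n : nat) (beta : nat -> nat -> R) :=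
  moment_mx_on (monomials n) beta.

Definition psd (R : realType) (m : nat) (A : 'M[R]_m) : Prop :=
  A^T = A /\ forall v : 'cV[R]_m, 0 <= (v^T *m A *m v) ord0 ord0.

Definition column_relation (R : realType) (n : nat) (beta : nat -> nat -> R)
    (q : {poly {poly R}}) : Prop :=
  total_degree_le n q /\
  \sum_k q`_(mon k).1`_(mon k).2 *: col k (moment_mx n beta) = 0.

Definition p_pure (R : realType) (p : {poly {poly R}}) (n : nat)
    (beta : nat -> nat -> R) : Prop :=
  forall q, column_relation n beta q <->
    total_degree_le n q /\ exists r, q = p * r.

Definition flat_extension (R : realType) (n : nat)
    (beta beta' : nat -> nat -> R) : Prop :=
  [/\ forall i j, (i + j <= 2 * n)%N -> beta' i j = beta i j,
      psd (moment_mx n.+1 beta') &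
      \rank (moment_mx n.+1 beta') = \rank (moment_mx n beta)].

(* The moments of degree at most 2n + 1; values in higher degree are never
   used. In degree 2n + 1 the indices (i + 3, 2n - i - 2) are (i'.+3, j). *)
Definition extended_moments (R : realType) (n : nat) (a b : R)
    (beta : nat -> nat -> R) (theta phi psi : R) (i j : nat) : R :=
  if (i + j <= 2 * n)%N then beta i j else
  match i with
  | 0 => psi
  | 1 => phi
  | 2 => theta
  | i'.+3 => beta i' j.+2 - a * beta i'.+1 j - b * beta i' j
  end.

Definition column_on (R : realType) (s : seq (nat * nat))
    (gamma : nat -> nat -> R) (i j : nat) : 'cV[R]_(size s) :=
  \col_k gamma (i + (mon k).1)%N (j + (mon k).2)%N.

(* The columns [X^2 Y^(n-1)]_B, [X Y^n]_B and [Y^(n+1)]_B; the first involves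
   theta only and the second theta and phi only, so the missing parameters are
   filled with 0. *)
Definition colX2 (R : realType) (n : nat) (a b : R) (beta : nat -> nat -> R)
    (theta : R) :=
  column_on (basisB n) (extended_moments n a b beta theta 0 0) 2 (n - 1).

Definition colX1 (R : realType) (n : nat) (a b : R) (beta : nat -> nat -> R)
    (theta phi : R) :=
  column_on (basisB n) (extended_moments n a b beta theta phi 0) 1 n.

Definition colX0 (R : realType) (n : nat) (a b : R) (beta : nat -> nat -> R)
    (theta phi psi : R) :=
  column_on (basisB n) (extended_moments n a b beta theta phi psi) 0 (n + 1).

Definition inv_form (R : realType) (n : nat) (beta : nat -> nat -> R)
    (u v : 'cV[R]_(size (basisB n))) : R :=
  (u^T *m invmx (moment_mx_on (basisB n) beta) *m v) ord0 ord0.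

Definition phi_star (R : realType) (n : nat) (a b : R) (beta : nat -> nat -> R)
    (theta : R) : R :=
  inv_form beta (colX2 n a b beta theta) (colX2 n a b beta theta)
  + a * beta 2 (2 * n - 2)%N + b * beta 1 (2 * n - 2)%N.

Definition psi_star (R : realType) (n : nat) (a b : R) (beta : nat -> nat -> R)
    (theta phi : R) : R :=
  inv_form beta (colX1 n a b beta theta phi) (colX2 n a b beta theta)
  + a * beta 1 (2 * n - 1)%N + b * beta 0 (2 * n - 1)%N.

Definition Qfun (R : realType) (n : nat) (a b : R) (beta : nat -> nat -> R)
    (theta phi psi : R) : R :=
  inv_form beta (colX0 n a b beta theta phi psi) (colX2 n a b beta theta)
  - inv_form beta (colX1 n a b beta theta phi) (colX1 n a b beta theta phi).

Definition Rfun (R : realType) (n : nat) (a b : R) (beta : nat -> nat -> R)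
    (theta : R) : R :=
  let phi := phi_star n a b beta theta in
  Qfun n a b beta theta phi (psi_star n a b beta theta phi).

(* Main.v *)
Require Import Defs.
From mathcomp Require Import all_boot all_order all_algebra.
From mathcomp Require Import all_classical all_reals all_analysis.
From mathcomp Require Import measurable_realfun complex zify ring lra.
Import Order.TTheory GRing.Theory Num.Theory numFieldNormedType.Exports.

Set Implicit Arguments.
Unset Strict Implicit.
Unset Printing Implicit Defensive.

Local Open Scope classical_set_scope.
Local Open Scope ring_scope.

(* A choice of the degree 2n+1 moments makes the space V of polynomials of
   degree at most n modulo the cubic into a Euclidean space with two self-adjoint
   operators, the compressions of multiplication by x and by y.  They commute on
   polynomials of degree at most n - 1, and on the three top basis monomials
   commutation is exactly phi = phi_*(theta), psi = psi_*(theta, phi) and Q = 0;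
   so it amounts to R(theta) = 0.  When they commute, the joint spectrum consists
   of dim V = rank M(n) distinct points of the curve, and diagonalization turns
   the form into an atomic measure with the given moments.  Conversely, an atomic
   measure with rank M(n) atoms has a flat moment matrix, flatness gives back the
   three equations, and since the atoms are joint eigenvalues of the two
   operators, theta determines all the moments, hence the measure. *)

(** * Commuting self-adjoint operators over a real closed field *)

(** The cubic dictates every moment of degree 2n + 1 with x-exponent at least 3, so three remain
    free. The commutator of the two operators is skew for the inner product, so on the three top
    monomials it leaves three scalar conditions. The first is linear in phi, the second in psi, and
    eliminating both leaves one equation in theta. It is quadratic only through a cancellation: with
    alpha the diagonal entry of the inverse of K at y^n, [phi_star] has leading term alpha theta^2,
    [psi_star] alpha^2 theta^3, and both halves of Q have the quartic term alpha^3 theta^4; the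
    cubic terms cancel too. A flat extension is not built directly from a root, since moments of
    degree 2n + 2 and positivity would have to be supplied. The measure comes first, and its own
    moments form the extension. Purity enters twice: it makes the moments obey the recurrence of the
    cubic, and it makes the form definite on the span of the basis monomials. *)

Definition quadr (R : rcfType) (s t : R) : {poly R} :=
  ('X - s%:P) ^+ 2 + (t ^+ 2)%:P.

Lemma size_quadr (R : rcfType) (s t : R) : size (quadr s t) = 3%N.
Proof.
rewrite /quadr size_polyDl size_exp_XsubC //.
by rewrite (leq_ltn_trans (size_polyC_leq1 _)).
Qed.

(** Take a root s + it in the algebraically closed extension R[i]. If t is nonzero, the remainder of
    p modulo [quadr s t] is real, has degree at most 1 and vanishes at a non-real number, so it is
    zero. *)
Lemma real_root_or_quadr (R : rcfType) (p : {poly R}) : (1 < size p)%N ->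
  (exists x, root p x) \/ exists s t, quadr s t %| p.
Proof.
move=> sp; pose f := real_complex R.
have /closed_rootP[[s t] rz] : size (map_poly f p) != 1%N.
  by rewrite size_map_poly; case: (size p) sp => [|[]].
have [t0|t0] := eqVneq t 0.
  by left; exists s; move: rz; rewrite t0 (fmorph_root f).
right; exists s, t; apply/modp_eq0P.
have : (map_poly f (p %% quadr s t)).[(s +i* t)%C] = 0.
  have := rz; rewrite {1}(divp_eq p (quadr s t)) rmorphD rmorphM /= rootE hornerD hornerM.
  have -> : (map_poly f (quadr s t)).[(s +i* t)%C] = 0.
    rewrite /quadr rmorphD rmorphXn rmorphB /= map_polyX !map_polyC /=.
    rewrite !(hornerE, horner_exp) /= expr2.
    by apply/eqP; rewrite eq_complex /=; apply/andP; split; apply/eqP; ring.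
  by rewrite mulr0 add0r => /eqP.
have : (size (p %% quadr s t)%R <= 2)%N.
  by have := ltn_modp p (quadr s t); rewrite -size_poly_gt0 size_quadr ltnS.
set r := p %% _ => sr.
have -> : r = r`_1 *: 'X + (r`_0)%:P.
  apply/polyP => i; rewrite coefD coefZ coefX coefC.
  case: i => [|[|i]] /=; rewrite ?(mulr1, mulr0, addr0, add0r) //.
  by rewrite nth_default // (leq_trans sr).
rewrite rmorphD /= map_polyZ /= map_polyX map_polyC /= !hornerE /=.
move=> /eqP; rewrite eq_complex /= => /andP[/eqP h1 /eqP h2].
have r1 : r`_1 = 0.
  by apply: (mulIf t0); move: h2; rewrite !mul0r !addr0.
have r0 : r`_0 = 0 by move: h1; rewrite r1 !mul0r subr0 add0r.
by rewrite r1 r0 scale0r add0r.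
Qed.

(** For t = 0 the factor [quadr s t] is a double root, so a single hypothesis excludes both non-real
    and repeated roots. *)
Lemma dvdp_prod_distinct_XsubC (R : rcfType) (p : {poly R}) : p != 0 ->
  (forall s t, ~~ (quadr s t %| p)) ->
  exists2 rs, uniq rs & p %| \prod_(x <- rs) ('X - x%:P).
Proof.
move=> p0 hp.
suff [rs [urs _ h]] : exists rs, [/\ uniq rs, {in rs, forall x, root p x} &
   p %| \prod_(x <- rs) ('X - x%:P)] by exists rs.
have [m] := ubnP (size p); elim: m p p0 hp => // m IH p p0 hp sm.
have [s1|s1] := leqP (size p) 1.
  exists [::]; split => //; rewrite big_nil dvdp1 eqn_leq s1.
  by rewrite size_poly_gt0.
case: (real_root_or_quadr s1) => [[x]|[s [t h]]]; last by have := hp s t; rewrite h.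
rewrite -dvdp_XsubCl => /dvdpP[r pE].
have r0 : r != 0 by apply: contraNneq p0 => r0; rewrite pE r0 mul0r.
have sp : size p = (size r).+1.
  by rewrite pE size_Mmonic ?monicXsubC // size_XsubC addn2.
case: (IH r r0) => [s t||rs [urs rts dvd]].
- by apply: contra (hp s t) => h; rewrite pE dvdp_mulr.
- by rewrite -ltnS -sp.
exists (x :: rs); split.
- rewrite /= urs andbT; apply/negP => /rts; rewrite -dvdp_XsubCl => /dvdpP[q rE].
  have := hp x 0; rewrite pE rE /quadr expr0n /= addr0 expr2.
  by rewrite -mulrA dvdp_mull.
- move=> y; rewrite inE => /predU1P[->|/rts]; rewrite pE rootM.
    by rewrite root_XsubC eqxx orbT.
  by move=> ->.
- by rewrite big_cons pE mulrC dvdp_mul.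
Qed.

Section Posdef.
Variables (R : rcfType) (n : nat).

Definition posdef (K : 'M[R]_n) :=
  forall v : 'cV[R]_n, v != 0 -> 0 < (v^T *m K *m v) ord0 ord0.

Variable K : 'M[R]_n.
Hypothesis Kpos : posdef K.

Lemma posdef_eq0 (v : 'cV[R]_n) : (v^T *m K *m v) ord0 ord0 <= 0 -> v = 0.
Proof.
by move=> h; apply/eqP; apply: contraTT h => /Kpos; rewrite ltNge.
Qed.

Lemma posdef_ge0 (v : 'cV[R]_n) : 0 <= (v^T *m K *m v) ord0 ord0.
Proof.
have [->|/Kpos/ltW//] := eqVneq v 0.
by rewrite mulmx0 mxE.
Qed.

Lemma posdef_unitmx : K \in unitmx.
Proof.
rewrite -row_free_unit -kermx_eq0; apply/eqP/row_matrixP => i; rewrite row0.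
set u := row i _.
have uK : u *m K = 0 by apply/sub_kermxP; rewrite /u row_sub.
apply: trmx_inj; rewrite trmx0; apply: posdef_eq0.
by rewrite trmxK uK mul0mx mxE.
Qed.
End Posdef.

(* If ((A - s)^2 + t^2) v = 0 then <(A - s) v, (A - s) v> = - t^2 <v, v> for the
   inner product given by K, so (A - s) v = 0. *)
Lemma selfadjoint_quadr (R : rcfType) (n : nat) (K A : 'M[R]_n.+1) (s t : R)
    (r : {poly R}) : posdef K -> A^T *m K = K *m A ->
  horner_mx A (quadr s t * r) = 0 -> horner_mx A (('X - s%:P) * r) = 0.
Proof.
move=> Kpos KA h.
set B := horner_mx A r.
pose S := A - s%:M.
have hS : horner_mx A ('X - s%:P) = S by rewrite rmorphB /= horner_mx_X horner_mx_C.
have SK : S^T *m K = K *m S.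
  by rewrite /S linearB /= tr_scalar_mx mulmxBl mulmxBr KA scalar_mxC.
have eB : S *m S *m B + t ^+ 2 *: B = 0.
  rewrite -h rmorphM /= /quadr rmorphD rmorphXn /= hS horner_mx_C.
  by rewrite -/B expr2 mulrDl -[_%:M * B]/(_ *m B) mul_scalar_mx.
rewrite rmorphM /= hS -/B -mulmxE.
apply/matrixP => i j; rewrite [RHS]mxE.
have cE : col j (S *m B) = S *m col j B by rewrite !colE mulmxA.
suff : col j (S *m B) = 0 by move=> /matrixP/(_ i ord0); rewrite !mxE.
apply: (posdef_eq0 Kpos); rewrite cE trmx_mul.
set v := col j B.
have e2 : S *m (S *m v) + t ^+ 2 *: v = 0.
  have := congr1 (col j) eB; rewrite linearD linearZ /= linear0 => <-.
  by rewrite /v !colE !mulmxA.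
have -> : v^T *m S^T *m K *m (S *m v) = - (t ^+ 2 *: (v^T *m K *m v)).
  rewrite -(mulmxA _ S^T) SK !mulmxA -[_ *m S *m S *m v]mulmxA -!mulmxA.
  move/eqP: e2; rewrite addr_eq0 => /eqP ->.
  by rewrite !mulmxN -!scalemxAr.
rewrite !mxE oppr_le0 mulr_ge0 ?sqr_ge0 //.
by have := posdef_ge0 Kpos v; rewrite mxE.
Qed.

(** A factor [quadr s t] of the minimal polynomial could be replaced by X - s, giving an
    annihilating polynomial of smaller degree. Hence the minimal polynomial splits into distinct
    real linear factors. *)
Lemma selfadjoint_diagonalizable (R : rcfType) (n : nat) (K A : 'M[R]_n) :
  posdef K -> A^T *m K = K *m A -> diagonalizable A.
Proof.
case: n K A => [|n] K A Kpos KA.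
  exists 1%:M; first exact: unitmx1.
  by apply/is_diag_mxP => -[].
apply/diagonalizableP; apply: dvdp_prod_distinct_XsubC.
  by rewrite monic_neq0 // mxminpoly_monic.
move=> s t; apply/negP => /dvdpP[r mE].
have m0 : mxminpoly A != 0 by rewrite monic_neq0 // mxminpoly_monic.
have r0 : r != 0 by apply: contraNneq m0 => r0; rewrite mE r0 mul0r.
have h : horner_mx A (('X - s%:P) * r) = 0.
  apply: (selfadjoint_quadr (t := t) Kpos KA).
  by rewrite mulrC -mE mx_root_minpoly.
have d := mxminpoly_min h.
have /(dvdp_leq _) := d; rewrite mulf_neq0 ?polyXsubC_eq0 // => /(_ isT).
rewrite mE !size_mul ?polyXsubC_eq0 // -?size_poly_gt0 ?size_quadr //.
by rewrite size_XsubC addn3 /= ltnn.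
Qed.

Lemma commuting_selfadjoint (R : rcfType) (n : nat) (K A B : 'M[R]_n) :
    posdef K -> A^T *m K = K *m A -> B^T *m K = K *m B -> A *m B = B *m A ->
  exists P, exists x y : 'rV[R]_n, [/\ P \in unitmx,
    P *m A = diag_mx x *m P & P *m B = diag_mx y *m P].
Proof.
move=> Kpos KA KB AB.
have : codiagonalizable [:: A; B].
  apply/codiagonalizableP; split.
    move=> C D; rewrite !inE => /orP[]/eqP-> /orP[]/eqP-> //.
  by move=> C; rewrite !inE => /orP[]/eqP->; apply: (selfadjoint_diagonalizable Kpos).
move=> [P Pu] /=; rewrite andbT => /andP[/similar_diagPex[x hx] /similar_diagPex[y hy]].
exists P, x, y; split => //.
  by move: hx => /(similarP Pu).
by move: hy => /(similarP Pu).
Qed.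

(** * Monomials and moment matrices *)

Lemma mon_mem s (k : 'I_(size s)) : mon k \in s.
Proof. exact: mem_nth. Qed.

Lemma mon_surj s m : m \in s -> exists k : 'I_(size s), mon k = m.
Proof.
move=> ms; have h : (index m s < size s)%N by rewrite index_mem.
by exists (Ordinal h); rewrite /mon nth_index.
Qed.

Lemma mon_inj s : uniq s -> injective (@mon s).
Proof.
by move=> us k l /eqP; rewrite /mon nth_uniq // => /eqP /val_inj.
Qed.

Lemma basisBS n : (0 < n)%N ->
  basisB n.+1 = basisB n ++ [:: (2, n.-1); (1, n); (0, n.+1)]%N.
Proof.
case: n => // n _.
have iotaE : iota 2 n.+2.-1 = iota 2 n.+1.-1 ++ [:: n.+2].
  by have := iotaD 2 n 1; rewrite addn1 add2n.
by rewrite /basisB iotaE map_cat flatten_cat catA /= !subSS !subn0.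
Qed.

Lemma mem_basisB n i j : (0 < n)%N ->
  ((i, j) \in basisB n) = (i <= 2)%N && (i + j <= n)%N.
Proof.
elim: n => // -[_ _|n IH _].
  by case: i => [|[|[|i]]]; case: j => [|[|j]].
rewrite basisBS // mem_cat IH // !inE !xpair_eqE.
by case: i {IH} => [|[|[|i]]] /=; lia.
Qed.

Lemma uniq_basisB n : (0 < n)%N -> uniq (basisB n).
Proof.
elim: n => // -[_ _ //|n IH _].
rewrite basisBS // cat_uniq IH //= !mem_basisB //= !addSn.
by lia.
Qed.

Lemma mem_monomials n i j : ((i, j) \in monomials n) = (i + j <= n)%N.
Proof.
apply/flatten_mapP/idP => [[d]|h].
  rewrite mem_iota => hd /mapP[k]; rewrite mem_iota => hk [-> ->]; lia.
exists (i + j)%N; first by rewrite mem_iota; lia.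
apply/mapP; exists j; first by rewrite mem_iota; lia.
by rewrite addnK.
Qed.

Lemma monomials_basisB n : (0 < n)%N -> {subset basisB n <= monomials n}.
Proof. by move=> n0 [i j]; rewrite mem_basisB // mem_monomials => /andP[]. Qed.

Lemma monomialsS n : {subset monomials n <= monomials n.+1}.
Proof. by move=> [i j]; rewrite !mem_monomials; lia. Qed.

Lemma uniq_monomials n : uniq (monomials n).
Proof.
elim: n => // n IH.
have iotaE : iota 0 n.+2 = iota 0 n.+1 ++ [:: n.+1].
  by have := iotaD 0 n.+1 1; rewrite addn1 add0n.
rewrite /monomials iotaE map_cat flatten_cat cat_uniq -/(monomials n) IH.
have flattenE (T : Type) (s : seq T) : flatten [:: s] = s by rewrite /= cats0.
rewrite [map _ [:: _]]/map flattenE map_inj_uniq ?iota_uniq ?andbT; last first.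
  by move=> j k [].
 apply/hasPn => -[i j] /mapP[k]; rewrite mem_iota => hk [-> ->].
by rewrite mem_monomials; lia.
Qed.

Lemma moment_mx_mxsub (R : realType) (s t : seq (nat * nat)) :
  {subset s <= t} -> exists f : 'I_(size s) -> 'I_(size t),
    (forall k, mon (f k) = mon k) /\
    forall beta : nat -> nat -> R,
      moment_mx_on s beta = mxsub f f (moment_mx_on t beta).
Proof.
move=> st; have h (k : 'I_(size s)) : exists l : 'I_(size t), mon l = mon k.
  by apply/mon_surj/st/mon_mem.
have [f hf] := choice h; exists f; split => // beta.
by apply/matrixP => i j; rewrite !mxE !hf.
Qed.

Lemma mxsubE (R : comRingType) (m n : nat) (f : 'I_m -> 'I_n) (A : 'M[R]_n) :
  mxsub f f A = rowsub f 1%:M *m A *m (rowsub f 1%:M)^T.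
Proof.
rewrite mul_rowsub_mx mul1mx; apply/matrixP => i j; rewrite !mxE.
rewrite (bigD1 (f j)) //= !mxE eqxx mulr1 big1 ?addr0 // => k kj.
by rewrite !mxE eq_sym (negbTE kj) mulr0.
Qed.

Lemma quadratic_ge0_linear_eq0 (R : realFieldType) (q c : R) : 0 <= q ->
  (forall t, 0 <= t ^+ 2 * q + 2 * t * c) -> c = 0.
Proof.
move=> q0 h; have q1 : q + 1 != 0 by rewrite gt_eqF //; lra.
(* The minimizer would be -c/q; the shift by 1 covers q = 0 and still gives a negative value unless
   c = 0. *)
have := h (- (c / (q + 1))).
have -> : (- (c / (q + 1))) ^+ 2 * q + 2 * - (c / (q + 1)) * c
     = - ((q + 2) * (c / (q + 1)) ^+ 2) by field.
rewrite oppr_ge0 pmulr_rle0; last lra.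
move=> h2; have : c / (q + 1) = 0.
  by apply/eqP; rewrite -sqrf_eq0 eq_le h2 sqr_ge0.
by move/eqP; rewrite mulf_eq0 invr_eq0 (negbTE q1) orbF => /eqP.
Qed.

(** Evaluated at t w + v with w = A v, the form has no constant term and linear coefficient twice
    the squared Euclidean norm of w, which nonnegativity for all t forces to vanish. *)
Lemma psd_kernel (R : realType) (m : nat) (A : 'M[R]_m) (v : 'cV[R]_m) :
  psd A -> (v^T *m A *m v) ord0 ord0 = 0 -> A *m v = 0.
Proof.
move=> [sA pA] v0; set w := A *m v.
have wE : v^T *m A = w^T by rewrite /w trmx_mul sA.
pose q (u : 'cV[R]_m) : R := (u^T *m A *m u) ord0 ord0.
pose c : R := (w^T *m w) ord0 ord0.
have qE t : q (t *: w + v) = t ^+ 2 * q w + 2 * t * c.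
  have trE : (t *: w + v)^T = t *: w^T + v^T by apply/matrixP => i j; rewrite !mxE.
  rewrite /q trE !mulmxDl !mulmxDr -!scalemxAl -!scalemxAr.
  have D (B C : 'M[R]_1) : (B + C) ord0 ord0 = B ord0 ord0 + C ord0 ord0 by rewrite mxE.
  have Z x (B : 'M[R]_1) : (x *: B) ord0 ord0 = x * B ord0 ord0 by rewrite mxE.
  rewrite -[w^T *m A *m v]mulmxA -/w !(D, Z) v0 wE -/c; ring.
have c0 : c = \sum_i w i ord0 ^+ 2.
  by rewrite /c mxE; apply: eq_bigr => i _; rewrite mxE expr2.
have cge : 0 <= c by rewrite c0 sumr_ge0 // => i _; rewrite sqr_ge0.
have qge : 0 <= q w := pA w.
have : c = 0.
  by apply: (@quadratic_ge0_linear_eq0 _ (q w)) => // t; rewrite -qE; apply: pA.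
move=> /eqP; rewrite c0 psumr_eq0 => [/allP h|i _]; last exact: sqr_ge0.
apply/matrixP => i j; rewrite ord1 [RHS]mxE.
by have := h i (mem_index_enum _); rewrite /= sqrf_eq0 => /eqP.
Qed.

(** * Consequences of purity: the cubic recurrence and definiteness *)

Definition xymon (R : comNzRingType) (c : R) (i j : nat) : {poly {poly R}} :=
  c%:P%:P * 'X ^+ i * 'Y ^+ j.

Lemma coef_xymon (R : comNzRingType) (c : R) i j k l :
  (xymon c i j)`_k`_l = c *+ ((k, l) == (i, j)).
Proof.
rewrite /xymon -rmorphXn mulrAC -rmorphM coefCM coefXn xpair_eqE.
case: (k == i) => /=; last by rewrite mulr0 coef0.
by rewrite mulr1 coefCM coefXn mulr_natr.
Qed.

Lemma cubic_xymon (R : realType) (a b c : R) i j :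
  cubic a b * xymon c i j =
  xymon c i j.+2 - xymon c i.+3 j - xymon (a * c) i.+1 j - xymon (b * c) i j.
Proof.
have pCM (u v : R) : (u * v)%:P%:P = u%:P%:P * v%:P%:P by rewrite !rmorphM.
rewrite /cubic /xymon !pCM !exprS; move: (a%:P%:P) (b%:P%:P) (c%:P%:P) 'Y => A B C Y.
by ring.
Qed.

Lemma sum_mon (V : nmodType) (s : seq (nat * nat)) (F : nat * nat -> V) :
  \sum_(k < size s) F (mon k) = \sum_(m <- s) F m.
Proof. by rewrite (big_nth (0, 0)%N) big_mkord. Qed.

Lemma sum_xymon (R : comNzRingType) (s : seq (nat * nat)) (F : nat * nat -> R) c i j :
  uniq s -> (i, j) \in s ->
  \sum_(m <- s) (xymon c i j)`_m.1`_m.2 * F m = c * F (i, j).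
Proof.
move=> us ijs; rewrite (bigD1_seq (i, j)) //= coef_xymon eqxx mulr1n.
rewrite big1 ?addr0 // => -[k l] kl.
by rewrite coef_xymon (negbTE kl) mulr0n mul0r.
Qed.

Lemma total_degree_le_cubic_xymon (R : realType) (a b c : R) (n i j : nat) :
  (i + j + 3 <= n)%N -> total_degree_le n (cubic a b * xymon c i j).
Proof.
move=> h k l; apply: contraNT; rewrite -ltnNge => kl.
rewrite cubic_xymon !coefB !coef_xymon !xpair_eqE.
have -> : (k == i) && (l == j.+2) = false by lia.
have -> : (k == i.+3) && (l == j) = false by lia.
have -> : (k == i.+1) && (l == j) = false by lia.
have -> : (k == i) && (l == j) = false by lia.
by rewrite !mulr0n !subr0.
Qed.

(** The relation is solved for x^3 rather than y^2, so that it reduces every monomial to those of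
    x-degree at most 2, as in [basisB]. *)
Definition cubic_recurrence (R : realType) (a b : R) (d : nat)
    (gamma : nat -> nat -> R) :=
  forall i j, (i.+3 + j <= d)%N ->
    gamma i.+3 j = gamma i j.+2 - a * gamma i.+1 j - b * gamma i j.

Lemma degree_split s t i j : (i + j <= s + t)%N ->
  exists i1 j1 i2 j2, [/\ i = (i1 + i2)%N, j = (j1 + j2)%N,
    (i1 + j1 <= s)%N & (i2 + j2 <= t)%N].
Proof.
move=> h; exists (minn i s), (minn j (s - i)), (i - s)%N, (j - (s - i))%N.
by split; lia.
Qed.

Lemma p_pure_recurrence (R : realType) (a b : R) (n : nat) (beta : nat -> nat -> R) :
  (3 <= n)%N -> p_pure (cubic a b) n beta ->
  cubic_recurrence a b (2 * n) beta.
Proof.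
move=> n3 pure i j h.
(* A multiple of the cubic by a monomial of degree at most n - 3 is a column relation; reading it in
   a row of degree at most n reaches all moments up to degree 2n. *)
have : (i + j <= (n - 3) + n)%N by lia.
move=> /degree_split[i1 [j1 [i2 [j2 [-> -> h1 h2]]]]].
have [_ ] := pure (cubic a b * xymon 1 i1 j1).
case.
  split; last by exists (xymon 1 i1 j1).
  by apply: total_degree_le_cubic_xymon; lia.
move=> _; have /mon_surj[k hk] : (i2, j2) \in monomials n by rewrite mem_monomials.
move=> /matrixP/(_ k ord0); rewrite summxE [RHS]mxE.
under eq_bigr => l _ do rewrite !mxE hk /=.
rewrite (sum_mon _ (fun m => (cubic a b * xymon 1 i1 j1)`_m.1`_m.2 *
   beta (i2 + m.1)%N (j2 + m.2)%N)).
under eq_bigr => m _ do rewrite cubic_xymon !coefB !mulrBl.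
rewrite !sumrB !sum_xymon ?uniq_monomials ?mem_monomials //=; try by lia.
rewrite !mulr1 !mul1r !addnS ![(i2 + _)%N]addnC ![(j2 + _)%N]addnC => e.
rewrite -!addSn.
apply/eqP; rewrite -subr_eq0 -oppr_eq0; apply/eqP; rewrite -[RHS]e.
by ring.
Qed.

Lemma moment_mx_tr (R : realType) (s : seq (nat * nat)) (beta : nat -> nat -> R) :
  (moment_mx_on s beta)^T = moment_mx_on s beta.
Proof. by apply/matrixP => k l; rewrite !mxE [((mon l).1 + _)%N]addnC [((mon l).2 + _)%N]addnC. Qed.

Lemma size_cubic (R : realType) (a b : R) : size (cubic a b) = 4%N.
Proof.
have -> : cubic a b = - 'X ^+ 3 + ((- a)%:P%:P * 'X + ('X ^+ 2 - b%:P)%:P).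
  by rewrite /cubic rmorphB rmorphXn !rmorphN /=; ring.
rewrite size_polyDl size_polyN size_polyXn // size_MXaddC.
by case: ifP => // _; rewrite ltnS (leq_ltn_trans (size_polyC_leq1 _)).
Qed.

(** An isotropic vector is a column relation supported on [basisB], hence a multiple of the cubic.
    Its x-degree is at most 2 while the cubic has x-degree 3, so it is zero. *)
Lemma p_pure_posdef (R : realType) (a b : R) (n : nat) (beta : nat -> nat -> R) :
  (3 <= n)%N -> psd (moment_mx n beta) -> p_pure (cubic a b) n beta ->
  posdef (moment_mx_on (basisB n) beta).
Proof.
move=> n3 Mpsd pure v v0; have n0 : (0 < n)%N by lia.
have [f [fE /(_ beta)->]] := moment_mx_mxsub R (monomials_basisB n0).
set M := moment_mx_on _ _; rewrite mxsubE !mulmxA.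
pose E : 'M[R]__ := rowsub f 1%:M.
have -> : v^T *m E *m M *m E^T *m v = (E^T *m v)^T *m M *m (E^T *m v).
  by rewrite trmx_mul trmxK !mulmxA.
rewrite lt_def Mpsd.2 andbT; apply: contra_neq v0 => /(psd_kernel Mpsd).
set u := E^T *m v => Mu0.
pose q := \sum_k xymon (v k ord0) (mon k).1 (mon k).2.
have qE k : q`_(mon k).1`_(mon k).2 = u k ord0.
  rewrite /q !coef_sum mxE; apply: eq_bigr => l _.
  rewrite coef_xymon -!surjective_pairing -fE (inj_eq (mon_inj (uniq_monomials _))).
  by rewrite !mxE eq_sym -mulr_natl.
have [qcol _] := pure q.
have [] := qcol.
  split; last first.
    rewrite -[RHS]Mu0; apply/matrixP => k l; rewrite ord1 summxE [RHS]mxE.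
    by apply: eq_bigr => m _; rewrite [LHS]mxE [X in _ * X]mxE qE mulrC.
  move=> i j; rewrite /q !coef_sum => /eqP h; rewrite leqNgt; apply/negP => ij.
  apply: h; rewrite big1 // => k _; rewrite coef_xymon.
  case: eqP => [e|]; last by rewrite mulr0n.
  have := mon_mem k; rewrite -surjective_pairing in e; rewrite -e mem_basisB //; lia.
move=> _ [r qr].
have q3 : (size q <= 3)%N.
  apply/leq_sizeP => i i3; apply/polyP => j; rewrite coef0 coef_sum coef_sum.
  rewrite big1 // => k _; rewrite coef_xymon.
  case: eqP => [e|]; last by rewrite mulr0n.
  have := mon_mem k; rewrite -surjective_pairing in e; rewrite -e mem_basisB //; lia.
have r0 : r = 0.
  have c0 : cubic a b != 0 by rewrite -size_poly_gt0 size_cubic.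
  apply/eqP; apply: contraTT q3 => r0; rewrite qr size_mul // size_cubic.
  by move: r0; rewrite -size_poly_gt0; case: (size r).
apply/matrixP => k l; rewrite ord1 [RHS]mxE.
have : q`_(mon k).1`_(mon k).2 = 0 by rewrite qr r0 mulr0 !coef0.
rewrite /q !coef_sum (bigD1 k) //= coef_xymon eqxx mulr1n big1 ?addr0 // => m mk.
rewrite coef_xymon -!surjective_pairing (inj_eq (mon_inj (uniq_basisB n0))).
by rewrite eq_sym (negbTE mk).
Qed.

Lemma mon_basisB n (k : 'I_(size (basisB n))) : (0 < n)%N ->
  ((mon k).1 + (mon k).2 <= n)%N.
Proof.
move=> n0; have := monomials_basisB n0 (mon_mem k).
by case: (mon k) => i j; rewrite mem_monomials.
Qed.

(** * Multiplication operators *)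

Section MonomialVectors.
Variables (R : realType) (n : nat) (a b : R) (gamma : nat -> nat -> R).
Hypothesis n_gt0 : (0 < n)%N.

Local Notation N := (size (basisB n)).
Local Notation K := (moment_mx_on (basisB n) gamma).
Local Notation mcol := (column_on (basisB n) gamma).

Hypothesis Kpos : posdef K.
Let Kunit : K \in unitmx := posdef_unitmx Kpos.

(* The coordinates on [basisB n] of the orthogonal projection of x^i y^j, of
   degree at most n + 1, onto the polynomials of degree at most n. *)
Definition mvec (i j : nat) : 'cV[R]_N := invmx K *m mcol i j.

Definition mform (i j k l : nat) : R :=
  ((mvec i j)^T *m K *m mvec k l) ord0 ord0.

Lemma mul_mvec i j : K *m mvec i j = mcol i j.
Proof. by rewrite /mvec mulKVmx. Qed.

Lemma mform_column i j k l :
  mform i j k l = ((mvec i j)^T *m mcol k l) ord0 ord0.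
Proof. by rewrite /mform -mulmxA mul_mvec. Qed.

Lemma mform_sum i j k l : mform i j k l =
  \sum_m mvec i j m ord0 * gamma (k + (mon m).1)%N (l + (mon m).2)%N.
Proof. by rewrite mform_column mxE; apply: eq_bigr => m _; rewrite !mxE. Qed.

Lemma mform_inv i j k l :
  mform i j k l = ((mcol i j)^T *m invmx K *m mcol k l) ord0 ord0.
Proof. by rewrite mform_column trmx_mul trmx_inv moment_mx_tr. Qed.

Lemma mformC i j k l : mform i j k l = mform k l i j.
Proof.
have tr11 (A : 'M[R]_1) : A ord0 ord0 = A^T ord0 ord0 by rewrite mxE.
rewrite /mform; move: (mvec i j) (mvec k l) => u v.
by rewrite [LHS]tr11 !trmx_mul trmxK moment_mx_tr mulmxA.
Qed.

Lemma mvec_mon k : mvec (mon k).1 (mon k).2 = delta_mx k ord0.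
Proof.
rewrite -[RHS](mulKmx Kunit).
congr (_ *m _); rewrite -colE; apply/matrixP => l o.
by rewrite !mxE addnC [((mon k).2 + _)%N]addnC.
Qed.

Section Recurrence.
Variable d : nat.
Hypothesis gamma_rec : cubic_recurrence a b d gamma.

Lemma mvec_rec i j : (i.+3 + j + n <= d)%N ->
  mvec i.+3 j = mvec i j.+2 - a *: mvec i.+1 j - b *: mvec i j.
Proof.
move=> h; rewrite /mvec !scalemxAr -!mulmxBr; congr (_ *m _).
apply/matrixP => k o; rewrite !mxE !addSn gamma_rec //.
by have := mon_basisB k n_gt0; lia.
Qed.

Lemma mform_rec i j k l : (i.+3 + j + n <= d)%N ->
  mform i.+3 j k l = mform i j.+2 k l - a * mform i.+1 j k l - b * mform i j k l.
Proof.
move=> h; rewrite !mform_sum (mvec_rec h) !mulr_sumr -!sumrB.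
by apply: eq_bigr => m _; rewrite !mxE; ring.
Qed.

(** Only one factor must have degree at most n: projecting the other does not change its pairing
    with it. The recurrence lowers the x-exponent of the first factor until it is a basis monomial,
    whose vector is a unit vector. *)
Lemma mform_moment i j k l : (i + j <= n)%N -> (n + k + l <= d)%N -> (n + n <= d)%N ->
  mform i j k l = gamma (i + k)%N (j + l)%N.
Proof.
have [m] := ubnP i; elim: m i j => // m IH i j im ij kl nd.
have [i2|i3] := leqP i 2.
  have /mon_surj[r rE] : (i, j) \in basisB n by rewrite mem_basisB // i2.
  have -> : i = (mon r).1 by rewrite rE.
  have -> : j = (mon r).2 by rewrite rE.
  rewrite mform_sum mvec_mon (bigD1 r) //= big1 => [|s /negbTE sr].
    by rewrite !mxE !eqxx mul1r addr0 addnC [(l + _)%N]addnC.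
  by rewrite !mxE sr mul0r.
case: i i3 im ij => [|[|[|i]]] // _ im ij.
rewrite mform_rec; last by lia.
rewrite !IH; try lia.
have -> : (i.+3 + k = (i + k).+3)%N by [].
by rewrite gamma_rec; [|lia].
Qed.

End Recurrence.

(* [mulop 1 0] and [mulop 0 1] are the compressions of multiplication by x and
   by y. *)
Definition shift_mx (s t : nat) : 'M[R]_N := \matrix_(k, l)
  gamma ((mon k).1 + (mon l).1 + s)%N ((mon k).2 + (mon l).2 + t)%N.

Definition mulop (s t : nat) : 'M[R]_N := invmx K *m shift_mx s t.

Lemma mulop_selfadjoint s t : (mulop s t)^T *m K = K *m mulop s t.
Proof.
rewrite /mulop mulKVmx // trmx_mul trmx_inv moment_mx_tr mulmxKV //.
apply/matrixP => k l; rewrite !mxE.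
by rewrite [((mon l).1 + _)%N]addnC [((mon l).2 + _)%N]addnC.
Qed.

Section DegreeOdd.
Hypothesis gamma_rec : cubic_recurrence a b (2 * n).+1 gamma.

(** In degree at most n the vector represents the monomial itself, so multiplying it is exact; the
    result may have degree n + 1 and is then a projection. *)
Lemma mulop_mvec s t i j : (s + t <= 1)%N -> (i + j <= n)%N ->
  mulop s t *m mvec i j = mvec (i + s) (j + t).
Proof.
move=> st ij; rewrite /mulop -mulmxA; congr (_ *m _).
apply/matrixP => k o; rewrite ord1 [RHS]mxE.
have hk : ((mon k).1 + (mon k).2 <= n)%N.
  exact: mon_basisB.
rewrite -!addnA -(mform_moment gamma_rec) //; try lia.
rewrite mform_sum mxE; apply: eq_bigr => l _; rewrite !mxE mulrC; congr (_ * gamma _ _); lia.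
Qed.

Hypothesis eq11 : mform 2 (n - 1) 2 (n - 1) =
  gamma 1%N (2 * n)%N - a * gamma 2%N (2 * n - 2)%N - b * gamma 1%N (2 * n - 2)%N.
Hypothesis eq12 : mform 1 n 2 (n - 1) =
  gamma 0%N (2 * n).+1 - a * gamma 1%N (2 * n - 1)%N - b * gamma 0%N (2 * n - 1)%N.
Hypothesis eq22 : mform 0 n.+1 2 (n - 1) = mform 1 n 1 n.
Hypothesis n_gt1 : (1 < n)%N.

(** Among the products of a top basis monomial by x or y, x^3 y^(n-2) alone reduces modulo the cubic
    to degree at most n, so its pairings are known moments. *)
Lemma mform3 k l : (k + l <= n.+1)%N -> mform 3 (n - 2) k l =
  gamma k (n + l)%N - a * gamma k.+1 (n - 2 + l)%N - b * gamma k (n - 2 + l)%N.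
Proof.
move=> kl; rewrite (mform_rec gamma_rec); last lia.
rewrite !(mform_moment gamma_rec); try lia.
by congr (gamma _ _ - _ * gamma _ _ - _ * gamma _ _); lia.
Qed.

(** If either monomial has degree below n, both sides are the same moment. For two top monomials the
    case i = k is symmetry, and the three unordered pairs that remain are the hypotheses [eq11],
    [eq12] and [eq22]. *)
Lemma mform_swap i j k l : (i <= 2)%N -> (k <= 2)%N -> (i + j <= n)%N ->
  (k + l <= n)%N -> mform i.+1 j k l.+1 = mform i j.+1 k.+1 l.
Proof.
move=> i2 k2 ij kl.
have [ij1|ij1] := ltnP (i + j) n.
  by rewrite !(mform_moment gamma_rec) ?addSn ?addnS //; lia.
have [kl1|kl1] := ltnP (k + l) n.
  by rewrite ![mform _ _ k _]mformC ![mform _ _ k.+1 _]mformC !(mform_moment gamma_rec) ?addSn ?addnS //; lia.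
have -> : j = (n - i)%N by lia.
have -> : l = (n - k)%N by lia.
have e1 : (n - 1).+1 = n by lia.
have e2 : (n - 2).+1 = (n - 1)%N by lia.
have h1 : mform 3 (n - 2) 1 n = mform 2 (n - 1) 2 (n - 1).
  have h : (1 + n <= n.+1)%N by [].
  rewrite (mform3 h) eq11.
  by congr (gamma _ _ - _ * gamma _ _ - _ * gamma _ _); lia.
have h2 : mform 3 (n - 2) 0 n.+1 = mform 2 (n - 1) 1 n.
  have h : (0 + n.+1 <= n.+1)%N by [].
  rewrite (mform3 h) mformC eq12.
  by congr (gamma _ _ - _ * gamma _ _ - _ * gamma _ _); lia.
case: i i2 {ij ij1} => [|[|[|i]]] // _; case: k k2 {kl kl1} => [|[|[|k]]] // _;
  rewrite ?subn0 ?e1 ?e2 //.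
- by rewrite mformC.
- by rewrite [RHS]mformC h2 mformC.
- by rewrite mformC eq22.
- by rewrite mformC.
- by rewrite [RHS]mformC h1.
- by rewrite mformC.
Qed.

Lemma mulop_comm : mulop 1 0 *m mulop 0 1 = mulop 0 1 *m mulop 1 0.
Proof.
(* Self-adjointness moves the left operator to the other side of the form, so each entry pairs two
   shifted basis monomials. *)
have ent s t s' t' (k l : 'I_N) : (s + t <= 1)%N -> (s' + t' <= 1)%N ->
    (K *m (mulop s t *m mulop s' t')) k l =
    mform ((mon k).1 + s) ((mon k).2 + t) ((mon l).1 + s') ((mon l).2 + t').
  move=> st st'.
  have h (m : 'I_N) : ((mon m).1 + (mon m).2 <= n)%N.
    exact: mon_basisB.
  rewrite /mform -!mulop_mvec // !mvec_mon trmx_mul trmx_delta.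
  rewrite -[_ *m _ *m K]mulmxA mulop_selfadjoint.
  have -> (A B : 'M[R]_N) : delta_mx ord0 k *m (K *m A) *m (B *m delta_mx l ord0) =
     (delta_mx ord0 k *m (K *m (A *m B)) *m delta_mx l ord0 : 'M[R]_1).
    by rewrite !mulmxA.
  by rewrite -rowE -colE !mxE.
have K0 (A B : 'M[R]_N) : K *m A = K *m B -> A = B.
  by move=> h; rewrite -(mulKmx Kunit A) h mulKmx.
apply: K0; apply/matrixP => k l; rewrite !ent //.
have hk := mon_mem k; have hl := mon_mem l.
move: hk hl; rewrite [mon k]surjective_pairing [mon l]surjective_pairing.
rewrite !mem_basisB // => /andP[? ?] /andP[? ?].
by rewrite !addn0 !addn1 mform_swap.
Qed.

End DegreeOdd.
End MonomialVectors.

Lemma mul_diag_mxE (R : comNzRingType) m n (d : 'rV[R]_m) (A : 'M[R]_(m, n)) i j :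
  (diag_mx d *m A) i j = d ord0 i * A i j.
Proof. by rewrite mul_diag_mx mxE. Qed.

Lemma mul_mx_diagE (R : comNzRingType) m n (d : 'rV[R]_n) (A : 'M[R]_(m, n)) i j :
  (A *m diag_mx d) i j = A i j * d ord0 j.
Proof. by rewrite mul_mx_diag mxE. Qed.

(** * Quadrature from commuting operators *)

Section Quadrature.
Variables (R : realType) (n : nat) (a b : R) (gamma : nat -> nat -> R).

Local Notation N := (size (basisB n)).
Local Notation K := (moment_mx_on (basisB n) gamma).
Local Notation vec := (mvec n gamma).
Local Notation form := (mform n gamma).

Hypothesis n_gt1 : (1 < n)%N.
Hypothesis Kpos : posdef K.
Hypothesis gamma_rec : cubic_recurrence a b (2 * n).+1 gamma.
Hypothesis eq11 : form 2 (n - 1) 2 (n - 1) =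
  gamma 1%N (2 * n)%N - a * gamma 2%N (2 * n - 2)%N - b * gamma 1%N (2 * n - 2)%N.
Hypothesis eq12 : form 1 n 2 (n - 1) =
  gamma 0%N (2 * n).+1 - a * gamma 1%N (2 * n - 1)%N - b * gamma 0%N (2 * n - 1)%N.
Hypothesis eq22 : form 0 n.+1 2 (n - 1) = form 1 n 1 n.

Let n_gt0 : (0 < n)%N := ltnW n_gt1.

Lemma quadrature : exists (z : 'I_N -> R * R) (w : 'I_N -> R),
  [/\ injective z, forall k, 0 < w k,
      forall k, (z k).2 ^+ 2 = (z k).1 ^+ 3 + a * (z k).1 + b &
      forall i j, (i + j <= (2 * n).+1)%N ->
        gamma i j = \sum_k w k * ((z k).1 ^+ i * (z k).2 ^+ j)].
Proof.
have comm := mulop_comm n_gt0 Kpos gamma_rec eq11 eq12 eq22 n_gt1.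
(* The rows of P are joint left eigenvectors, hence proportional to the
   evaluations of the basis monomials at the points (x_k, y_k). *)
have [P [x [y [Pu PX PY]]]] := commuting_selfadjoint Kpos
  (mulop_selfadjoint Kpos 1 0) (mulop_selfadjoint Kpos 0 1) comm.
pose t k := (P *m vec 0 0) k ord0.
have Pvec i j k : (i + j <= n.+1)%N ->
    (P *m vec i j) k ord0 = x ord0 k ^+ i * y ord0 k ^+ j * t k.
  elim: i j => [|i IH] j ij.
    elim: j ij => [|j IH] ij; first by rewrite !expr0 !mul1r.
    have := mulop_mvec n_gt0 Kpos gamma_rec (s := 0) (t := 1) (i := 0) (j := j) isT ij.
    rewrite addn0 addn1 => <-.
    by rewrite mulmxA PY -mulmxA mul_diag_mxE IH ?exprS; [ring|lia].
  have := mulop_mvec n_gt0 Kpos gamma_rec (s := 1) (t := 0) (i := i) (j := j) isT ij.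
  rewrite addn0 addn1 => <-.
  by rewrite mulmxA PX -mulmxA mul_diag_mxE IH ?exprS; [ring|lia].
have rowP (u : 'rV[R]_N) : u *m P = 0 -> u = 0.
  by move=> uP; rewrite -(mulmxK Pu u) uP mul0mx.
have Pent k l : P k l = x ord0 k ^+ (mon l).1 * y ord0 k ^+ (mon l).2 * t k.
  rewrite -Pvec; last by rewrite ltnW // ltnS mon_basisB.
  by rewrite mvec_mon // -colE mxE.
have t_neq0 k : t k != 0.
  apply/eqP => tk; have /rowP : (delta_mx ord0 k : 'rV[R]_N) *m P = 0.
    by rewrite -rowE; apply/matrixP => i j; rewrite !mxE Pent tk mulr0.
  by move=> /matrixP/(_ ord0 k)/eqP; rewrite !mxE !eqxx oner_eq0.
pose z k := (x ord0 k, y ord0 k).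
(* Two rows belonging to the same point would be proportional, contradicting the invertibility of
   P. *)
have z_inj : injective z.
  move=> k l [xkl ykl]; apply/eqP; apply: contraT => kl.
  have /rowP : (t l *: delta_mx ord0 k - t k *: delta_mx ord0 l : 'rV[R]_N) *m P = 0.
    rewrite mulmxBl -!scalemxAl -!rowE; apply/matrixP => i j.
    by rewrite !mxE !Pent xkl ykl; ring.
  move=> /matrixP/(_ ord0 k)/eqP; rewrite !mxE !eqxx (negbTE kl).
  by rewrite mulr1 mulr0 subr0 (negbTE (t_neq0 l)).
(* C is the Gram matrix in the joint eigenbasis. Self-adjointness makes it commute with both
   diagonal matrices, so an off-diagonal entry could survive only between equal points. *)
pose C := (invmx P)^T *m K *m invmx P.
have KE : K = P^T *m C *m P.
  by rewrite /C !mulmxA -trmx_mul mulVmx // trmx1 mul1mx mulmxKV.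
have Ccomm D (A : 'M[R]_N) : A^T *m K = K *m A -> P *m A = diag_mx D *m P ->
    C *m diag_mx D = diag_mx D *m C.
  move=> AK PA.
  have AE : A *m invmx P = invmx P *m diag_mx D.
    by rewrite -[LHS](mulKmx Pu) [P *m _]mulmxA PA mulmxK.
  have : (invmx P)^T *m (A^T *m K) *m invmx P = (invmx P)^T *m (K *m A) *m invmx P.
    by rewrite AK.
  rewrite mulmxA -trmx_mul AE trmx_mul tr_diag_mx -!mulmxA AE => e.
  by rewrite /C -!mulmxA e.
have Coff k l : k != l -> C k l = 0.
  move=> kl; apply/eqP; apply: contraNT kl => Ckl; apply/eqP/z_inj.
  have cx := Ccomm _ _ (mulop_selfadjoint Kpos 1 0) PX.
  have cy := Ccomm _ _ (mulop_selfadjoint Kpos 0 1) PY.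
  congr (_, _).
    move/matrixP/(_ k l) : cx; rewrite mul_mx_diagE mul_diag_mxE mulrC.
    by move=> /(mulIf Ckl).
  move/matrixP/(_ k l) : cy; rewrite mul_mx_diagE mul_diag_mxE mulrC.
  by move=> /(mulIf Ckl).
have Cpos k : 0 < C k k.
  pose v : 'cV[R]_N := invmx P *m delta_mx k ord0.
  have v0 : v != 0.
    apply: contraTneq isT => /(congr1 (mulmx P)); rewrite mulKVmx // mulmx0.
    by move=> /matrixP/(_ k ord0)/eqP; rewrite !mxE !eqxx oner_eq0.
  have := Kpos v0.
  rewrite /v trmx_mul trmx_delta.
  have -> : (delta_mx ord0 k *m (invmx P)^T *m K *m (invmx P *m delta_mx k ord0)) =
     (delta_mx ord0 k *m C *m delta_mx k ord0 : 'M[R]_1) by rewrite /C !mulmxA.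
  by rewrite -rowE -colE !mxE.
(* Row k of P is [t k] times evaluation at [z k]; the form uses that row twice, hence the square. *)
exists z, (fun k => C k k * t k ^+ 2); split => //.
- by move=> k; rewrite mulr_gt0 // lt_def sqr_ge0 sqrf_eq0 t_neq0.
- move=> k /=; apply: (mulIf (t_neq0 k)).
  (* The vector recurrence for x^3 holds as n >= 2; read in row k and divided by [t k], it is the
     equation of the curve. *)
  have h : (3 + 0 + n <= (2 * n).+1)%N by lia.
  have := congr1 (fun v => (P *m v) k ord0) (mvec_rec n_gt0 Kpos gamma_rec h).
  rewrite !mulmxBr -!scalemxAr.
  have D (A B : 'cV[R]_N) : (A - B) k ord0 = A k ord0 - B k ord0 by rewrite !mxE.
  have Z c (A : 'cV[R]_N) : (c *: A) k ord0 = c * A k ord0 by rewrite !mxE.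
  rewrite !(D, Z) !Pvec; try lia.
  by rewrite !expr0 !expr1 !mulr1 !mul1r !mulrDl => ->; ring.
(* Degree 2n + 1 is reached by pairing a factor of degree n, represented exactly, with a projected
   one of degree n + 1. *)
- move=> i j ij; have : (i + j <= n + n.+1)%N by lia.
  move=> /degree_split[i1 [j1 [i2 [j2 [-> -> h1 h2]]]]].
  rewrite -(mform_moment n_gt0 Kpos gamma_rec); try lia.
  rewrite /mform {1}KE.
  have -> (u v : 'cV[R]_N) : u^T *m (P^T *m C *m P) *m v =
     (P *m u)^T *m (C *m (P *m v)) by rewrite trmx_mul !mulmxA.
  rewrite mxE; apply: eq_bigr => k _; rewrite [X in X * _]mxE.
  rewrite Pvec; last lia.
  rewrite mxE (bigD1 k) //= big1 ?addr0 => [|l lk]; last by rewrite Coff 1?eq_sym ?mul0r.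
  by rewrite Pvec // !exprD; ring.
Qed.
End Quadrature.

Lemma moment_mx_on_eq (R : realType) (n d : nat) (s : seq (nat * nat))
    (beta gamma : nat -> nat -> R) :
  (forall i j, (i + j <= d)%N -> gamma i j = beta i j) ->
  (forall m : nat * nat, m \in s -> (m.1 + m.2 <= n)%N) -> (n + n <= d)%N ->
  moment_mx_on s gamma = moment_mx_on s beta.
Proof.
move=> e sn nd; apply/matrixP => k l; rewrite !mxE e //.
by have := sn _ (mon_mem k); have := sn _ (mon_mem l); lia.
Qed.

(** * Flat extensions *)

Section Rank.
Variables (R : realType) (n : nat) (a b : R).
Hypothesis n_gt0 : (0 < n)%N.
Local Notation N := (size (basisB n)).

Lemma basisB_degree (m : nat * nat) : m \in basisB n -> (m.1 + m.2 <= n)%N.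
Proof. by case: m => i j; rewrite mem_basisB // => /andP[]. Qed.

(** Writing all monomials in the basis factors M(n) through K, which bounds the rank above; the
    invertible principal submatrix K bounds it below. *)
Lemma rank_moment_mx (beta : nat -> nat -> R) :
  posdef (moment_mx_on (basisB n) beta) -> cubic_recurrence a b (2 * n) beta ->
  \rank (moment_mx n beta) = N.
Proof.
move=> Kpos rec; apply/eqP; rewrite eqn_leq; apply/andP; split.
  pose V : 'M[R]_(N, size (monomials n)) :=
    \matrix_(p, k) mvec n beta (mon k).1 (mon k).2 p ord0.
  have -> : moment_mx n beta = V^T *m (moment_mx_on (basisB n) beta *m V).
    apply/matrixP => k l.
    have hm (m : 'I_(size (monomials n))) : ((mon m).1 + (mon m).2 <= n)%N.
      by have := mon_mem m; case: (mon m) => i j; rewrite mem_monomials.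
    have hk := hm k; have hl := hm l.
    rewrite [LHS]mxE -(mform_moment n_gt0 Kpos rec); try lia.
    have -> : V^T = \matrix_(i, p) (row i V^T) ord0 p by apply/matrixP => i p; rewrite !mxE.
    rewrite /mform -mulmxA !mxE; apply: eq_bigr => p _.
    by rewrite !mxE; congr (_ * _); apply: eq_bigr => q _; rewrite !mxE.
  exact: leq_trans (mxrankM_maxl _ _) (rank_leq_col _).
rewrite -(mxrank_unit (posdef_unitmx Kpos)).
have [f [_ /(_ beta)->]] := moment_mx_mxsub R (monomials_basisB n_gt0).
rewrite mxsubE (leq_trans (mxrankM_maxl _ _)) // mxrankM_maxr //.
Qed.

(** When the rank does not grow, the rows of the basis monomials span the row space of M(n+1). The
    coefficients of any row in them must be [mvec], so the projection loses nothing, even for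
    moments of degree 2n + 2. *)
Lemma flat_mform (gamma : nat -> nat -> R) i j k l :
  posdef (moment_mx_on (basisB n) gamma) ->
  (\rank (moment_mx n.+1 gamma) <= N)%N ->
  (i + j <= n.+1)%N -> (k + l <= n.+1)%N ->
  mform n gamma i j k l = gamma (i + k)%N (j + l)%N.
Proof.
move=> Kpos rk ij kl; set M := moment_mx _ _ in rk.
have sub : {subset basisB n <= monomials n.+1}.
  by move=> m /(monomials_basisB n_gt0) /monomialsS.
have [f [fE /(_ gamma) KE]] := moment_mx_mxsub R sub.
have KMf : moment_mx_on (basisB n) gamma = colsub f (rowsub f M).
  by rewrite KE; apply/matrixP => p q; rewrite !mxE.
have rkf : (N <= \rank (rowsub f M))%N.
  rewrite -{1}(mxrank_unit (posdef_unitmx Kpos)) KMf.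
  by rewrite -{1}[rowsub f M]mulmx1 -mulmx_colsub mxrankM_maxl.
have subM : (rowsub f M <= M)%MS by rewrite rowsubE submxMl.
have : (M <= rowsub f M)%MS.
  by have := mxrank_leqif_sup subM => -[_ <-]; rewrite eqn_leq mxrankS //= (leq_trans rk).
move=> /submxP[D ME].
have /mon_surj[r rE] : (i, j) \in monomials n.+1 by rewrite mem_monomials.
have /mon_surj[s sE] : (k, l) \in monomials n.+1 by rewrite mem_monomials.
have Dr : mvec n gamma i j = (row r D)^T.
  rewrite -[RHS](mulKmx (posdef_unitmx Kpos)); congr (_ *m _).
  rewrite -[X in X *m _]moment_mx_tr -trmx_mul KMf.
  rewrite mulmx_colsub -row_mul -ME; apply/matrixP => p o.
  by rewrite !mxE rE fE.
rewrite mform_sum // Dr; transitivity (M r s); last by rewrite mxE rE sE.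
rewrite {1}ME mxE; apply: eq_bigr => p _; rewrite !mxE fE sE /=.
by rewrite addnC [(l + _)%N]addnC.
Qed.

(* Bootstraps the recurrence in a flat extension from degree 2n to degree 2n + 1,
   then to degree 2n + 2. *)
Lemma mform_recurrence (gamma : nat -> nat -> R) (s d : nat) :
  posdef (moment_mx_on (basisB n) gamma) ->
  (forall i j k l, (i + j <= n.+1)%N -> (k + l <= n.+1)%N ->
    mform n gamma i j k l = gamma (i + k)%N (j + l)%N) ->
  cubic_recurrence a b d gamma -> (3 <= s)%N -> (s <= n.+1)%N -> (n + s <= d)%N ->
  cubic_recurrence a b (s + n.+1) gamma.
Proof.
move=> Kpos flat rec s3 sn sd i j ij; have : (i + j <= (s - 3) + n.+1)%N by lia.
move=> /degree_split[i1 [j1 [i2 [j2 [-> -> h1 h2]]]]].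
have := mform_rec n_gt0 Kpos rec (i := i1) (j := j1) i2 j2.
by rewrite !flat; try lia; apply; lia.
Qed.

End Rank.

(** * The functions phi_*, psi_* and Q as values of the form *)

Section Star.
Variables (R : realType) (n : nat) (a b : R) (beta gamma : nat -> nat -> R).
Hypothesis n_gt1 : (1 < n)%N.
Hypothesis gammaE : forall i j, (i + j <= 2 * n)%N -> gamma i j = beta i j.
Hypothesis gamma_rec : cubic_recurrence a b (2 * n).+1 gamma.
Hypothesis Kpos : posdef (moment_mx_on (basisB n) gamma).
Let n_gt0 : (0 < n)%N := ltnW n_gt1.

Let theta := gamma 2%N (2 * n - 1).
Let phi := gamma 1%N (2 * n).
Let psi := gamma 0%N (2 * n).+1.

Lemma inv_form_column u v i j k l :
  u = column_on (basisB n) gamma i j -> v = column_on (basisB n) gamma k l ->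
  inv_form beta u v = mform n gamma i j k l.
Proof.
move=> -> ->; rewrite mform_inv // /inv_form.
rewrite (@moment_mx_on_eq _ n (2 * n) _ beta gamma) //; last by lia.
by move=> m; apply: basisB_degree.
Qed.

(** Each parameter is constrained only at the indices that can read it, so that columns whose absent
    parameters are filled with 0 are covered. *)
Lemma extended_momentsE (t f p : R) i j : (i + j <= (2 * n).+1)%N ->
  ((i <= 2)%N -> t = theta) -> ((i <= 1)%N -> f = phi) -> (i = 0%N -> p = psi) ->
  extended_moments n a b beta t f p i j = gamma i j.
Proof.
move=> ij ht hf hp; rewrite /extended_moments; case: leqP => [|ij2]; first by move/gammaE.
case: i ij ij2 ht hf hp => [|[|[|i]]] ij ij2 ht hf hp.
- by rewrite hp //; congr (gamma _ _); lia.
- by rewrite hf //; congr (gamma _ _); lia.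
- by rewrite ht //; congr (gamma _ _); lia.
- by rewrite gamma_rec // !gammaE //; lia.
Qed.

Lemma column_onE (t f p : R) i j : (i + j <= n.+1)%N ->
  ((i <= 2)%N -> t = theta) -> ((i <= 1)%N -> f = phi) -> (i = 0%N -> p = psi) ->
  column_on (basisB n) (extended_moments n a b beta t f p) i j =
  column_on (basisB n) gamma i j.
Proof.
move=> ij ht hf hp; apply/matrixP => k o; rewrite !mxE.
have := mon_basisB k n_gt0 => hk.
by apply: extended_momentsE => *; [lia|apply: ht|apply: hf|apply: hp]; lia.
Qed.

Lemma phi_starE : phi_star n a b beta theta =
  mform n gamma 2%N (n - 1) 2 (n - 1) + a * gamma 2%N (2 * n - 2)%N
  + b * gamma 1%N (2 * n - 2)%N.
Proof.
rewrite /phi_star -!gammaE; try lia.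
congr (_ + _ + _); apply: inv_form_column; apply: column_onE => //; lia.
Qed.

Lemma psi_starE : psi_star n a b beta theta phi =
  mform n gamma 1%N n 2 (n - 1) + a * gamma 1%N (2 * n - 1)%N
  + b * gamma 0%N (2 * n - 1)%N.
Proof.
rewrite /psi_star -!gammaE; try lia.
congr (_ + _ + _); apply: inv_form_column; apply: column_onE => //; lia.
Qed.

Lemma QfunE : Qfun n a b beta theta phi psi =
  mform n gamma 0%N n.+1 2 (n - 1) - mform n gamma 1%N n 1 n.
Proof.
rewrite /Qfun /colX0 addn1.
by congr (_ - _); apply: inv_form_column; apply: column_onE => //; lia.
Qed.
End Star.

(** * The degree of R in theta *)

Section RfunPolynomial.
Variables (R : realType) (n : nat) (a b : R) (beta : nat -> nat -> R).
Hypothesis n_gt1 : (1 < n)%N.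
Local Notation B := (@inv_form R n beta).

Lemma inv_formDl u v w : B (u + v) w = B u w + B v w.
Proof.
have trE : (u + v)^T = u^T + v^T by apply/matrixP => i j; rewrite !mxE.
by rewrite /inv_form trE !mulmxDl mxE.
Qed.

Lemma inv_formZl t u w : B (t *: u) w = t * B u w.
Proof.
have trE : (t *: u)^T = t *: u^T by apply/matrixP => i j; rewrite !mxE.
by rewrite /inv_form trE -!scalemxAl mxE.
Qed.

Lemma inv_formC u v : B u v = B v u.
Proof.
have tr11 (A : 'M[R]_1) : A ord0 ord0 = A^T ord0 ord0 by rewrite mxE.
by rewrite /inv_form tr11 !trmx_mul trmxK trmx_inv moment_mx_tr mulmxA.
Qed.

Lemma inv_formDr u v w : B w (u + v) = B w u + B w v.
Proof. by rewrite inv_formC inv_formDl inv_formC [B v w]inv_formC. Qed.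

Lemma inv_formZr t u w : B w (t *: u) = t * B w u.
Proof. by rewrite inv_formC inv_formZl inv_formC. Qed.

(** Marks the row of the top monomial x^i y^(n-i). Free moments occur only in top rows, so the three
    columns are affine in them along these directions. *)
Let e i : 'cV[R]_(size (basisB n)) := \col_k (mon k == (i, n - i)%N)%:R.

Let mon_cases (k : 'I_(size (basisB n))) :
  [\/ ((mon k).1 + (mon k).2 < n)%N, mon k = (0, n)%N, mon k = (1, n - 1)%N |
      mon k = (2, n - 2)%N].
Proof.
have := mon_mem k; case: (mon k) => i j; rewrite mem_basisB; last lia.
case: i => [|[|[|i]]] //= h; have [?|?] := ltnP (_ + j) n.
- by constructor 1.
- by constructor 2; congr (_, _); lia.
- by constructor 1.
- by constructor 3; congr (_, _); lia.
- by constructor 1.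
- by constructor 4; congr (_, _); lia.
Qed.

Lemma colX0_affine t f p :
  colX0 n a b beta t f p = colX0 n a b beta 0 0 0 + t *: e 2 + f *: e 1 + p *: e 0.
Proof.
apply/matrixP => k o; rewrite !mxE /extended_moments.
case: (mon_cases k) => [h|->|->|->] /=; rewrite ?xpair_eqE /=.
- have -> : (0 + (mon k).1 + (n + 1 + (mon k).2) <= 2 * n)%N by lia.
  have ne i : (i <= 2)%N -> (mon k == (i, n - i)%N) = false.
    by move=> i2; apply: contraTF h => /eqP -> /=; lia.
  by rewrite !ne // !mulr0 !addr0.
- have -> : (0 + 0 + (n + 1 + n) <= 2 * n)%N = false by lia.
  by rewrite /= subn0 eqxx mulr1n; ring.
- have -> : (0 + 1 + (n + 1 + (n - 1)) <= 2 * n)%N = false by lia.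
  by rewrite /= eqxx mulr1n; ring.
- have -> : (0 + 2 + (n + 1 + (n - 2)) <= 2 * n)%N = false by lia.
  by rewrite /= eqxx mulr1n; ring.
Qed.

Lemma colX1_affine t f :
  colX1 n a b beta t f = colX1 n a b beta 0 0 + t *: e 1 + f *: e 0.
Proof.
apply/matrixP => k o; rewrite !mxE /extended_moments.
case: (mon_cases k) => [h|->|->|->] /=; rewrite ?xpair_eqE /=.
- have -> : (1 + (mon k).1 + (n + (mon k).2) <= 2 * n)%N by lia.
  have ne i : (i <= 2)%N -> (mon k == (i, n - i)%N) = false.
    by move=> i2; apply: contraTF h => /eqP -> /=; lia.
  by rewrite !ne // !mulr0 !addr0.
- have -> : (1 + 0 + (n + n) <= 2 * n)%N = false by lia.
  by rewrite /= subn0 eqxx mulr1n; ring.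
- have -> : (1 + 1 + (n + (n - 1)) <= 2 * n)%N = false by lia.
  by rewrite /= eqxx mulr1n; ring.
- have -> : (1 + 2 + (n + (n - 2)) <= 2 * n)%N = false by lia.
  by rewrite /=; ring.
Qed.

Lemma colX2_affine t : colX2 n a b beta t = colX2 n a b beta 0 + t *: e 0.
Proof.
apply/matrixP => k o; rewrite !mxE /extended_moments.
case: (mon_cases k) => [h|->|->|->] /=; rewrite ?xpair_eqE /=.
- have -> : (2 + (mon k).1 + (n - 1 + (mon k).2) <= 2 * n)%N by lia.
  have ne i : (i <= 2)%N -> (mon k == (i, n - i)%N) = false.
    by move=> i2; apply: contraTF h => /eqP -> /=; lia.
  by rewrite !ne // !mulr0 !addr0.
- have -> : (2 + 0 + (n - 1 + n) <= 2 * n)%N = false by lia.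
  by rewrite /= subn0 eqxx mulr1n; ring.
- have -> : (2 + 1 + (n - 1 + (n - 1)) <= 2 * n)%N = false by lia.
  by rewrite /=; ring.
- have -> : (2 + 2 + (n - 1 + (n - 2)) <= 2 * n)%N = false by lia.
  by rewrite /=; ring.
Qed.

Lemma Rfun_poly : exists Rp : {poly R}, (size Rp <= 3)%N /\
  forall t, Rp.[t] = Rfun n a b beta t.
Proof.
(* The terms of degree 3 and 4 in theta cancel, so Rfun is interpolated at
   -1, 0 and 1. *)
pose r := Rfun n a b beta.
pose r1 := (r 1 - r (-1)) / 2; pose r2 := (r 1 + r (-1)) / 2 - r 0.
exists (Poly [:: r 0; r1; r2]); split; first exact: size_Poly.
move=> t; rewrite horner_Poly /= /r1 /r2 /r /Rfun /Qfun /psi_star /phi_star.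
rewrite mul0r add0r.
have h2 s := colX2_affine s; have h1 s f := colX1_affine s f.
have h0 s f p := colX0_affine s f p.
move: (colX2 n a b beta 0) (colX1 n a b beta 0 0) (colX0 n a b beta 0 0 0) h2 h1 h0.
move=> u v w h2 h1 h0.
rewrite ![colX0 _ _ _ _ _ _ _]h0 ![colX1 _ _ _ _ _ _]h1 ![colX2 _ _ _ _ _]h2.
rewrite !(inv_formDl, inv_formDr, inv_formZl, inv_formZr).
rewrite [B (e 0) u]inv_formC [B (e 1) v]inv_formC [B (e 0) v]inv_formC [B (e 0) (e 1)]inv_formC.
by field.
Qed.

End RfunPolynomial.

Definition atomic_moments (R : realType) (T : finType) (z : T -> R * R)
  (w : T -> R) (i j : nat) : R := \sum_k w k * ((z k).1 ^+ i * (z k).2 ^+ j).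

(** * Determinacy of atomic measures *)

Section MomentVanish.
Variables (R : realType) (T : finType) (z : T -> R * R) (c : T -> R).
Hypothesis c0 : forall i j, atomic_moments z c i j = 0.

(** A polynomial in v whose only real zero is u; products of such factors serve as Lagrange
    interpolation polynomials in the plane. *)
Let dist2 (u v : R * R) : R := (v.1 - u.1) ^+ 2 + (v.2 - u.2) ^+ 2.

Let dist2_eq0 u v : (dist2 u v == 0) = (v == u).
Proof.
rewrite paddr_eq0 ?sqr_ge0 // !sqrf_eq0 !subr_eq0.
by case: u v => [? ?] [? ?].
Qed.

Let prod_dist2_moments (s : seq (R * R)) i j :
  \sum_k c k * (\prod_(u <- s) dist2 u (z k)) * ((z k).1 ^+ i * (z k).2 ^+ j) = 0.
Proof.
elim: s i j => [|u s IH] i j.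
  by rewrite -[RHS](c0 i j); apply: eq_bigr => k _; rewrite big_nil mulr1.
transitivity (
  \sum_k (c k * (\prod_(u <- s) dist2 u (z k)) * ((z k).1 ^+ i.+2 * (z k).2 ^+ j)
  + (- 2 * u.1) * (c k * (\prod_(u <- s) dist2 u (z k)) * ((z k).1 ^+ i.+1 * (z k).2 ^+ j))
  + c k * (\prod_(u <- s) dist2 u (z k)) * ((z k).1 ^+ i * (z k).2 ^+ j.+2)
  + (- 2 * u.2) * (c k * (\prod_(u <- s) dist2 u (z k)) * ((z k).1 ^+ i * (z k).2 ^+ j.+1))
  + (u.1 ^+ 2 + u.2 ^+ 2) * (c k * (\prod_(u <- s) dist2 u (z k)) * ((z k).1 ^+ i * (z k).2 ^+ j)))).
  by apply: eq_bigr => k _; rewrite big_cons /dist2 !exprS; ring.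
by rewrite !big_split /= -!mulr_sumr !IH !mulr0 !addr0.
Qed.

(** Multiplying by the squared distances to all other atoms isolates p. Atoms may coincide, so only
    the total weight at a point is controlled. *)
Lemma atomic_moments_eq0_at (p : R * R) : \sum_(k | z k == p) c k = 0.
Proof.
pose s := [seq u <- codom z | u != p].
have := prod_dist2_moments s 0 0.
rewrite (bigID (fun k => z k == p)) /= [X in _ + X]big1 ?addr0 => [|k kp].
  rewrite (eq_bigr (fun k => c k * \prod_(u <- s) dist2 u p)) => [|k /eqP ->].
    rewrite -mulr_suml => /eqP; rewrite mulf_eq0 => /orP[/eqP //|].
    rewrite prodf_seq_eq0 => /hasP[u]; rewrite mem_filter => /andP[up _] /=.
    by rewrite dist2_eq0 eq_sym (negbTE up).
  by rewrite !expr0 !mulr1.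
rewrite !expr0 !mulr1; apply/eqP; rewrite mulf_eq0; apply/orP; right.
rewrite prodf_seq_eq0; apply/hasP; exists (z k).
  by rewrite mem_filter kp codom_f.
by rewrite /= dist2_eq0.
Qed.

Lemma atomic_moments_eq0 (g : R * R -> R) : \sum_k c k * g (z k) = 0.
Proof.
suff H (s : seq (R * R)) (h : R * R -> R) :
    (forall k, z k \notin s -> h (z k) = 0) -> \sum_k c k * h (z k) = 0.
  by apply: (H (codom z)) => k; rewrite codom_f.
elim: s h => [|p s IH] h hs; first by rewrite big1 // => k _; rewrite hs ?mulr0.
rewrite (bigID (fun k => z k == p)) /=.
rewrite (eq_bigr (fun k => c k * h p)) => [|k /eqP -> //].
rewrite -mulr_suml atomic_moments_eq0_at mul0r add0r.
have := IH (fun q => if q == p then 0 else h q).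
rewrite (bigID (fun k => z k == p)) /= big1 => [|k ->]; last by rewrite mulr0.
rewrite add0r => e; rewrite -[RHS]e; last first.
  by move=> k ks; case: eqP => // /eqP kp; rewrite hs // inE negb_or kp.
by apply: eq_bigr => k /negbTE ->.
Qed.

End MomentVanish.

Lemma atomic_moments_inj (R : realType) (S T : finType) (y : S -> R * R)
    (v : S -> R) (z : T -> R * R) (w : T -> R) (g : R * R -> R) :
  (forall i j, atomic_moments y v i j = atomic_moments z w i j) ->
  \sum_k v k * g (y k) = \sum_k w k * g (z k).
Proof.
move=> e.
(* The difference of the two measures is a signed one on the disjoint union of the index sets, where
   a common atom appears twice. *)
pose x (t : S + T) := match t with inl k => y k | inr k => z k end.
pose c (t : S + T) := match t with inl k => v k | inr k => - w k end.
have sumE (h : R * R -> R) :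
    \sum_t c t * h (x t) = \sum_k v k * h (y k) - \sum_k w k * h (z k).
  rewrite big_sumType /= -sumrN; congr (_ + _).
  by apply: eq_bigr => k _; rewrite mulNr.
apply/eqP; rewrite -subr_eq0 -sumE; apply/eqP/atomic_moments_eq0 => i j.
rewrite /atomic_moments (sumE (fun p => p.1 ^+ i * p.2 ^+ j)).
by apply/eqP; rewrite subr_eq0; apply/eqP/e.
Qed.

(** * Recovering all moments from those of degree at most 2n + 1 *)

Section Determined.
Variables (R : realType) (n : nat).
Hypothesis n_gt0 : (0 < n)%N.
Local Notation N := (size (basisB n)).

(** Computes x^i y^j by applying the operators to 1. Unlike [mvec], which reads moments of degree up
    to n + i + j, it never goes beyond degree 2n + 1. *)
Definition iter_mvec (gamma : nat -> nat -> R) i j : 'cV[R]_N :=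
  iter i (mulmx (mulop n gamma 1 0))
    (iter j (mulmx (mulop n gamma 0 1)) (mvec n gamma 0 0)).

Lemma iter_mvec_eq (gamma gamma' : nat -> nat -> R) :
  (forall i j, (i + j <= (2 * n).+1)%N -> gamma i j = gamma' i j) ->
  iter_mvec gamma =2 iter_mvec gamma'.
Proof.
move=> e i j.
have KE : moment_mx_on (basisB n) gamma = moment_mx_on (basisB n) gamma'.
  apply: (@moment_mx_on_eq _ n (2 * n).+1) => // [m|]; last lia.
  exact: basisB_degree.
have opE s t : (s + t <= 1)%N -> mulop n gamma s t = mulop n gamma' s t.
  move=> st; rewrite /mulop KE; congr (_ *m _); apply/matrixP => k l; rewrite !mxE e //.
  by have := mon_basisB k n_gt0; have := mon_basisB l n_gt0; lia.
rewrite /iter_mvec !opE //; congr (iter _ _ (iter _ _ _)).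
rewrite /mvec KE; congr (_ *m _); apply/matrixP => k o; rewrite !mxE e //.
by have := mon_basisB k n_gt0; lia.
Qed.

Section Atoms.
Variables (T : finType) (z : T -> R * R) (w : T -> R).
Hypothesis w_gt0 : forall k, 0 < w k.
Local Notation gamma := (atomic_moments z w).
Hypothesis Kpos : posdef (moment_mx_on (basisB n) gamma).
Hypothesis flat : forall i j k l, (i + j <= n.+1)%N -> (k + l <= n.+1)%N ->
  mform n gamma i j k l = gamma (i + k)%N (j + l)%N.

Definition eval_row k : 'rV[R]_N :=
  \row_m ((z k).1 ^+ (mon m).1 * (z k).2 ^+ (mon m).2).

Lemma eval_row_mvec k i j : (i + j <= n.+1)%N ->
  (eval_row k *m mvec n gamma i j) ord0 ord0 = (z k).1 ^+ i * (z k).2 ^+ j.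
Proof.
move=> ij; pose f k : R := (z k).1 ^+ i * (z k).2 ^+ j.
pose g k : R := (eval_row k *m mvec n gamma i j) ord0 ord0.
have gE m : g m = \sum_p mvec n gamma i j p ord0 *
    ((z m).1 ^+ (mon p).1 * (z m).2 ^+ (mon p).2).
  by rewrite /g mxE; apply: eq_bigr => p _; rewrite !mxE mulrC.
have fg r s : (r + s <= n.+1)%N ->
    \sum_m w m * (g m * ((z m).1 ^+ r * (z m).2 ^+ s)) = gamma (i + r)%N (j + s)%N.
  move=> rs; rewrite -flat // mform_sum // /atomic_moments.
  under [RHS]eq_bigr => p _ do rewrite mulr_sumr.
  rewrite exchange_big /=; apply: eq_bigr => m _.
  rewrite gE mulr_suml mulr_sumr; apply: eq_bigr => p _.
  by rewrite !exprD; ring.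
have gg : \sum_m w m * (g m * g m) = gamma (i + i)%N (j + j)%N.
  rewrite -(flat ij ij) mform_sum //.
  transitivity (\sum_p mvec n gamma i j p ord0 *
      \sum_m w m * (g m * ((z m).1 ^+ (mon p).1 * (z m).2 ^+ (mon p).2))).
    under [RHS]eq_bigr => p _ do rewrite mulr_sumr.
    rewrite exchange_big /=; apply: eq_bigr => m _.
    rewrite {2}gE !mulr_sumr; apply: eq_bigr => p _; ring.
  apply: eq_bigr => p _; rewrite fg //.
  by rewrite (leq_trans (mon_basisB p n_gt0)).
(* By flatness x^i y^j minus its projection has norm 0, so it vanishes at the
   atoms. *)
have : \sum_m w m * (f m - g m) ^+ 2 = 0.
  transitivity (\sum_m w m * (f m * f m) - 2 * (\sum_m w m * (g m * f m))
      + \sum_m w m * (g m * g m)).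
    rewrite mulr_sumr -sumrB -big_split /=; apply: eq_bigr => m _; ring.
  rewrite gg fg // /f /atomic_moments.
  rewrite (eq_bigr (fun m => w m * ((z m).1 ^+ (i + i) * (z m).2 ^+ (j + j)))).
    by ring.
  by move=> m _; rewrite !exprD; ring.
move=> /eqP; rewrite psumr_eq0 => [/allP/(_ k (mem_index_enum _))/=|m _]; last first.
  by rewrite mulr_ge0 ?sqr_ge0 // ltW.
by rewrite mulf_eq0 gt_eqF //= sqrf_eq0 subr_eq0 => /eqP/esym.
Qed.

Variables (a b : R).
Hypothesis gamma_rec : cubic_recurrence a b (2 * n).+1 gamma.

(** An operator sends a basis monomial to a vector of degree at most n + 1, where evaluation at an
    atom is still exact. Atoms are thus joint eigenvalues. *)
Lemma eval_row_mulop k s t : (s + t <= 1)%N ->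
  eval_row k *m mulop n gamma s t = ((z k).1 ^+ s * (z k).2 ^+ t) *: eval_row k.
Proof.
move=> st; apply/matrixP => o l; rewrite ord1 {o}.
have -> : (eval_row k *m mulop n gamma s t) ord0 l =
    (eval_row k *m (mulop n gamma s t *m delta_mx l ord0 : 'cV_N)) ord0 ord0.
  by rewrite mulmxA -colE [RHS]mxE.
rewrite -(mvec_mon Kpos) (mulop_mvec n_gt0 Kpos gamma_rec) //; last exact: mon_basisB.
rewrite eval_row_mvec; last by have := mon_basisB l n_gt0; lia.
by rewrite !mxE !exprD; ring.
Qed.

Lemma eval_row_iter_mvec k i j :
  (eval_row k *m iter_mvec gamma i j) ord0 ord0 = (z k).1 ^+ i * (z k).2 ^+ j.
Proof.
rewrite /iter_mvec; elim: i => [|i IH] /=.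
  elim: j => [|j IH] /=; first by rewrite eval_row_mvec.
  by rewrite mulmxA eval_row_mulop // -scalemxAl mxE IH !exprS; ring.
by rewrite mulmxA eval_row_mulop // -scalemxAl mxE IH !exprS; ring.
Qed.

(** At every atom x^i y^j agrees with the combination of basis monomials given by [iter_mvec];
    integrating expresses any moment by data of degree at most 2n + 1. *)
Lemma atomic_momentsE i j : gamma i j =
  \sum_m gamma (mon m).1 (mon m).2 * iter_mvec gamma i j m ord0.
Proof.
rewrite {1}/atomic_moments.
under eq_bigr => k _ do rewrite -eval_row_iter_mvec mxE mulr_sumr.
rewrite exchange_big /=; apply: eq_bigr => m _.
by rewrite mulr_suml; apply: eq_bigr => k _; rewrite mxE; ring.
Qed.

End Atoms.
End Determined.

(** * Plane measures with finite support *)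

Section Plane.
Variable R : realType.

(** A countable base of the plane consisting of measurable rectangles: it links open sets to the
    product sigma-algebra. *)
Definition ratbox (t : (rat * rat) * (rat * rat)) : set (R * R) :=
  [set` `]ratr t.1.1, ratr t.1.2[] `*` [set` `]ratr t.2.1, ratr t.2.2[].

Lemma measurable_ratbox t : measurable (ratbox t).
Proof. by apply: measurableX; exact: measurable_itv. Qed.

Lemma nbhs_rat_itv (x : R) (A : set R) : nbhs x A ->
  exists p q : rat, (x \in `]ratr p, ratr q[) /\ ([set` `]ratr p, ratr q[] `<=` A).
Proof.
move=> /nbhs_ballP[e /= e0 eA].
have [p hp] : exists p : rat, ratr p \in `]x - e, x[.
  by apply: rat_in_itvoo; lra.
have [q hq] : exists q : rat, ratr q \in `]x, x + e[.
  by apply: rat_in_itvoo; lra.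
move: hp hq; rewrite !in_itv /= => /andP[p1 p2] /andP[q1 q2].
exists p, q; split; first by rewrite in_itv /= p2 q1.
move=> y /=; rewrite in_itv /= => /andP[y1 y2]; apply: eA.
by rewrite /ball /= ltr_norml; apply/andP; split; lra.
Qed.

Lemma open_ratbox (U : set (R * R)) z : open U -> U z ->
  exists t, ratbox t z /\ ratbox t `<=` U.
Proof.
move=> oU Uz; have : nbhs z U by apply: open_nbhs_nbhs.
case: z Uz => x y Uz [[A B] /= [nA nB] AB].
have [p [q [hx hA]]] := nbhs_rat_itv nA.
have [p' [q' [hy hB]]] := nbhs_rat_itv nB.
exists ((p, q), (p', q')); split; first by split.
by move=> [u v] [/= hu hv]; apply: AB; split; [apply: hA|apply: hB].
Qed.

Lemma open_measurable_plane (U : set (R * R)) : open U -> measurable U.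
Proof.
move=> oU; pose F t := if `[< ratbox t `<=` U >] then ratbox t else set0.
have -> : U = \bigcup_t F t.
  apply/seteqP; split=> z.
    move=> /(open_ratbox oU)[t [tz tU]]; exists t => //.
    by rewrite /F; case: asboolP.
  by move=> [t _]; rewrite /F; case: asboolP => // tU /tU.
apply: countable_bigcupT_measurable; first exact: countableP.
by move=> t; rewrite /F; case: asboolP => // _; apply: measurable_ratbox.
Qed.

Lemma measurable_plane_set1 (z : R * R) : measurable [set z].
Proof.
have -> : [set z] = [set z.1] `*` [set z.2].
  by apply/seteqP; split=> -[x y] /= => [<-//|[-> ->]]; rewrite -surjective_pairing.
by apply: measurableX; exact: measurable_set1.
Qed.

(** Each point off the support lies in a null rational box, and there are countably many boxes. *)
Lemma msuppC_null (mu : plane_measure R) : mu.-negligible (~` msupp mu).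
Proof.
pose F (k : nat) : set (R * R) :=
  if unpickle k is Some t then
    if mu (ratbox t) == 0%E then ratbox t else set0
  else set0.
have : mu.-negligible (\bigcup_k F k).
  apply: negligible_bigcup => k; rewrite /F; case: unpickle => [t|]; last exact: negligible_set0.
  case: ifPn => [/eqP h|_]; last exact: negligible_set0.
  by apply/negligibleP => //; exact: measurable_ratbox.
apply: negligibleS => z /existsNP[U /not_implyP[oU /not_implyP[Uz /negP]]].
rewrite -leNgt => mU0.
have [t [tz tU]] := open_ratbox oU Uz.
suff mt : mu (ratbox t) = 0%E.
  exists (pickle t); first exact: Logic.I.
  by rewrite /F pickleK mt eqxx.
apply/eqP; rewrite eq_le measure_ge0 andbT; apply: le_trans mU0.
by apply: le_measure => //; rewrite inE; [exact: measurable_ratbox|exact: open_measurable_plane].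
Qed.

Definition atomic (r : nat) (z : 'I_r -> R * R) (w : 'I_r -> R)
    (mu : plane_measure R) :=
  forall A, measurable A -> mu A = (\sum_k w k * \1_A (z k))%:E.

Lemma finite_msupp_atomic r (mu : plane_measure R) :
    (mu setT < +oo)%E -> (msupp mu #= `I_r)%card ->
  exists (z : 'I_r -> R * R) (w : 'I_r -> R),
    [/\ injective z, forall k, 0 < w k, forall k, msupp mu (z k) & atomic z w mu].
Proof.
move=> mufin; rewrite card_eq_sym => /card_set_bijP[f [f1 f2 f3]].
pose z (k : 'I_r) := f k.
have z_inj : injective z.
  move=> k l kl; apply/val_inj/(f2 _ _ _ _ kl); rewrite inE /=; exact: ltn_ord.
have suppE : msupp mu = \big[setU/set0]_(k < r) [set z k].
  rewrite /z -(bigcup_mkord r (fun k => [set f k])).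
  by apply/seteqP; split => [x /f3[k /= kr <-]|x [k /= kr ->]]; [exists k|exact: f1].
have fin A : measurable A -> mu A \is a fin_num.
  move=> mA; rewrite ge0_fin_numE ?measure_ge0 //; apply: le_lt_trans mufin.
  by apply: le_measure; rewrite ?inE.
have mS : measurable (msupp mu).
  by rewrite suppE; apply: bigsetU_measurable => k _; exact: measurable_plane_set1.
have muE A : measurable A -> mu A = (\sum_k fine (mu [set z k]) * \1_A (z k))%:E.
  move=> mA.
  have -> : mu A = mu (A `&` msupp mu).
    rewrite -[X in mu X = _]setIT -(setUv (msupp mu)) setIUr measureU0 //.
    - exact: measurableI.
    - by apply: measurableI => //; exact: measurableC.
    apply/negligibleP; first by apply: measurableI => //; exact: measurableC.
    apply: negligibleS (msuppC_null mu); exact: subIsetr.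
  rewrite suppE big_distrr /= measure_bigsetU_ord => [|k|]; last first.
  - apply/trivIsetP => k l _ _ kl; apply/seteqP; split => // p [[_ ->] [_]].
    by move=> /z_inj e; move: kl; rewrite e eqxx.
  - by apply: measurableI => //; exact: measurable_plane_set1.
  rewrite -sumEFin; apply: eq_bigr => k _; rewrite indicE.
  have [Ak|Ak] := pselect (A (z k)).
    rewrite mem_set // mulr1 fineK; last by apply: fin; exact: measurable_plane_set1.
    by congr (mu _); apply/seteqP; split => [p []//|p /= ->].
  rewrite memNset // mulr0 (_ : A `&` _ = set0) ?measure0 //.
  by apply/seteqP; split => // p [Ap /= pz]; apply: Ak; rewrite -pz.
exists z, (fun k => fine (mu [set z k])); split => //; last first.
  by move=> k; apply/f1/ltn_ord.
(* The complement of the other atoms is an open neighbourhood of [z k] of mass exactly the k-th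
   weight, positive by definition of the support. *)
move=> k; pose others := [set p | exists2 l, l != k & p = z l].
have others_fin : finite_set others.
  apply: (@sub_finite_set _ _ (range z)); first by move=> p [l _ ->]; exists l.
  exact: finite_image.
have others_open : open (~` others).
  have [accP _] := @accessible_finite_set_closed (R * R)%type.
  rewrite openC; apply: accP others_fin.
  exact/hausdorff_accessible/norm_hausdorff.
have Hk : (~` others) (z k) by move=> [l lk /z_inj e]; move: lk; rewrite e eqxx.
have := (f1 k (ltn_ord k) : msupp mu (z k)) _ others_open Hk.
rewrite muE; last exact: open_measurable_plane.
rewrite (bigD1 k) //= big1 => [|l lk].
  by rewrite addr0 indicE mem_set // mulr1 lte_fin.
by rewrite indicE memNset ?mulr0 // => h; apply: h; exists l.
Qed.
End Plane.

(** * Integration against finitely many atoms *)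

Section AtomicIntegral.
Variables (R : realType) (r : nat) (z : 'I_r -> R * R) (w : 'I_r -> R).
Hypothesis w_ge0 : forall k, 0 <= w k.

Let summand (k : nat) : plane_measure R :=
  if insub k is Some l then mscale (NngNum (w_ge0 l)) (dirac (z l)) else mzero.

Definition atomic_measure : plane_measure R := msum summand r.

Let summand_ord (k : 'I_r) :
  summand k = mscale (NngNum (w_ge0 k)) (dirac (z k)).
Proof. by rewrite /summand valK. Qed.

Lemma atomic_measureE A : atomic_measure A = (\sum_k w k * \1_A (z k))%:E.
Proof.
rewrite /atomic_measure /= /msum -sumEFin; apply: eq_bigr => k _.
by rewrite summand_ord /= /mscale /= diracE indicE EFinM.
Qed.

Lemma atomic_measure_atomic : atomic z w atomic_measure.
Proof. by move=> A _; rewrite atomic_measureE. Qed.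

Let ge0_integral_atomic (f : R * R -> R) : measurable_fun setT f ->
  (forall x, 0 <= f x) ->
  (\int[atomic_measure]_x (f x)%:E = (\sum_k w k * f (z k))%:E)%E.
Proof.
move=> mf f0.
have mEf : measurable_fun setT (EFin \o f) by apply/measurable_EFinP.
rewrite /atomic_measure ge0_integral_measure_sum //; last first.
  by move=> x _; rewrite lee_fin.
rewrite -sumEFin; apply: eq_bigr => k _; rewrite summand_ord.
rewrite ge0_integral_mscale //; last by move=> x _; rewrite lee_fin.
by rewrite integral_dirac // diracT mul1e EFinM.
Qed.

Lemma integral_atomic (mu : plane_measure R) (f : R * R -> R) :
  atomic z w mu -> measurable_fun setT f ->
  mu.-integrable setT (fun x => (f x)%:E) /\
  (\int[mu]_x (f x)%:E = (\sum_k w k * f (z k))%:E)%E.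
Proof.
move=> muE mf.
have eqmu (g : R * R -> \bar R) : (\int[mu]_x g x = \int[atomic_measure]_x g x)%E.
  by apply: eq_measure_integral => A mA _; rewrite muE // atomic_measureE.
split.
  apply/integrableP; split; first exact/measurable_EFinP.
  rewrite eqmu (_ : (fun x => _) = (fun x => `|f x|%:E)); last by [].
  rewrite ge0_integral_atomic ?ltry //.
  exact: measurableT_comp.
rewrite eqmu integralE.
have mpos : measurable_fun setT (fun x => Num.max (f x) 0).
  by apply: measurable_maxr.
have mneg : measurable_fun setT (fun x => Num.max (- f x) 0).
  by apply: measurable_maxr => //; exact: measurableT_comp.
under eq_integral => x _ do rewrite funeposE -EFin_max.
under [X in (_ - X)%E]eq_integral => x _ do rewrite funenegE -EFinN -EFin_max.
rewrite !ge0_integral_atomic //; try by move=> x; rewrite le_max lexx orbT.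
rewrite -EFinB; congr (_%:E); rewrite -sumrB; apply: eq_bigr => k _.
rewrite -mulrBr; congr (_ * _); have [f0|f0] := leP 0 (f (z k)).
  by rewrite (max_idPr _) ?oppr_le0 // subr0.
by rewrite (max_idPl _) ?oppr_ge0 ?ltW // sub0r opprK.
Qed.

Lemma measurable_monomial i j :
  measurable_fun setT (fun p : R * R => p.1 ^+ i * p.2 ^+ j).
Proof.
apply: measurable_funM; apply: measurable_funX.
  exact: measurable_fst.
exact: measurable_snd.
Qed.

Lemma moment_atomic (mu : plane_measure R) i j : atomic z w mu ->
  mu.-integrable setT (fun p : R * R => (p.1 ^+ i * p.2 ^+ j)%:E) /\
  (\int[mu]_p (p.1 ^+ i * p.2 ^+ j)%:E = (atomic_moments z w i j)%:E)%E.
Proof. by move=> muE; apply: integral_atomic => //; exact: measurable_monomial. Qed.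

End AtomicIntegral.

Section AtomicSupport.
Variables (R : realType) (r : nat) (z : 'I_r -> R * R) (w : 'I_r -> R).
Hypothesis z_inj : injective z.
Hypothesis w_gt0 : forall k, 0 < w k.
Let w_ge0 k : 0 <= w k := ltW (w_gt0 k).

Lemma msupp_atomic_measure : msupp (atomic_measure z w_ge0) = range z.
Proof.
apply/seteqP; split => [p Hp|_ [k _ <-] U oU Uz].
  apply: contrapT => pz.
  have zfin : finite_set (range z) by exact: finite_image.
  have [accP _] := @accessible_finite_set_closed (R * R)%type.
  have oz : open (~` range z).
    by rewrite openC; apply: accP zfin; exact/hausdorff_accessible/norm_hausdorff.
  have := Hp _ oz pz; rewrite atomic_measureE big1 ?ltxx // => k _.
  by rewrite indicE memNset ?mulr0 // => h; apply: h; exists k.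
rewrite atomic_measureE lte_fin (bigD1 k) //= ltr_pwDl //.
  by rewrite indicE mem_set // mulr1.
by apply: sumr_ge0 => l _; rewrite mulr_ge0.
Qed.

Lemma card_msupp_atomic_measure : (msupp (atomic_measure z w_ge0) #= `I_r)%card.
Proof.
rewrite msupp_atomic_measure.
apply: card_eq_trans (inj_card_eq _) _; first by move=> k l _ _; exact: z_inj.
by rewrite card_eq_sym card_II.
Qed.
End AtomicSupport.

(** * The equivalences *)

(** V is the Vandermonde matrix of the atoms; the factorization yields positivity and bounds the
    rank by the number of atoms. *)
Lemma moment_mx_atomic (R : realType) (T : finType) (z : T -> R * R) (w : T -> R) s :
  let V := \matrix_(k < #|T|, m < size s)
    ((z (enum_val k)).1 ^+ (mon m).1 * (z (enum_val k)).2 ^+ (mon m).2) in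
  moment_mx_on s (atomic_moments z w) =
  V^T *m (diag_mx (\row_k w (enum_val k)) *m V).
Proof.
move=> V; apply/matrixP => k l; rewrite mxE [RHS]mxE /atomic_moments.
rewrite (reindex_onto enum_val enum_rank) => [/=|t _]; last exact: enum_rankK.
rewrite (eq_bigl xpredT) => [|t]; last by rewrite enum_valK eqxx.
by apply: eq_bigr => t _; rewrite mul_diag_mxE !mxE !exprD; ring.
Qed.

Lemma psd_moment_mx_atomic (R : realType) (T : finType) (z : T -> R * R) (w : T -> R) s :
  (forall k, 0 <= w k) -> psd (moment_mx_on s (atomic_moments z w)).
Proof.
move=> w0; split=> [|v]; first exact: moment_mx_tr.
rewrite moment_mx_atomic; set V := \matrix_(_, _) _; set D := diag_mx _.
have -> : v^T *m (V^T *m (D *m V)) *m v = (V *m v)^T *m (D *m (V *m v)).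
  by rewrite trmx_mul !mulmxA.
rewrite mxE; apply: sumr_ge0 => k _; rewrite mul_diag_mxE [X in X * _]mxE [X in _ * (X * _)]mxE.
by rewrite mulrCA -expr2 mulr_ge0 ?sqr_ge0.
Qed.

Section Main.
Variables (R : realType) (n : nat) (a b : R) (beta : nat -> nat -> R).
Hypothesis hn : (3 <= n)%N.
Hypothesis hpsd : psd (moment_mx n beta).
Hypothesis hpure : p_pure (cubic a b) n beta.

Let n_gt0 : (0 < n)%N. Proof. lia. Qed.
Let n_gt1 : (1 < n)%N. Proof. lia. Qed.
Let Kpos : posdef (moment_mx_on (basisB n) beta) := p_pure_posdef hn hpsd hpure.
Let rec : cubic_recurrence a b (2 * n) beta := p_pure_recurrence hn hpure.
Let rankM : \rank (moment_mx n beta) = size (basisB n) := rank_moment_mx n_gt0 Kpos rec.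

Local Notation N := (size (basisB n)).
Local Notation is_measure :=
  (atomic_representing_measure (\rank (moment_mx n beta)) (cubic a b) n beta).

Let posdef_ext (gamma : nat -> nat -> R) :
  (forall i j, (i + j <= 2 * n)%N -> gamma i j = beta i j) ->
  posdef (moment_mx_on (basisB n) gamma).
Proof.
move=> e; rewrite (@moment_mx_on_eq _ n (2 * n) _ beta gamma) //; last lia.
exact: basisB_degree.
Qed.

Lemma measure_atomic mu : is_measure mu ->
  exists (z : 'I_N -> R * R) (w : 'I_N -> R),
  [/\ injective z, forall k, 0 < w k, atomic z w mu &
      forall i j, (i + j <= 2 * n)%N -> atomic_moments z w i j = beta i j].
Proof.
move=> [[_ mom]]; rewrite rankM => card.
(* The total mass is the moment of degree 0. *)
have mufin : (mu setT < +oo)%E.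
  have [_] := mom 0%N 0%N isT.
  rewrite (eq_integral (cst 1%E)) => [|x _]; last by rewrite !expr0 mulr1.
  by rewrite integral_cst // mul1e => ->; rewrite ltry.
have [z [w [z_inj w_gt0 _ muE]]] := finite_msupp_atomic mufin card.
exists z, w; split => // i j ij; have [_] := mom i j ij.
by have [_ ->] := moment_atomic (fun k => ltW (w_gt0 k)) i j muE; case.
Qed.

Lemma atomic_flat (z : 'I_N -> R * R) (w : 'I_N -> R) : (forall k, 0 < w k) ->
  (forall i j, (i + j <= 2 * n)%N -> atomic_moments z w i j = beta i j) ->
  flat_extension n beta (atomic_moments z w).
Proof.
move=> w_gt0 e; split => //.
  by apply: psd_moment_mx_atomic => k; exact: ltW.
apply/eqP; rewrite eqn_leq; apply/andP; split.
  rewrite rankM /moment_mx moment_mx_atomic (leq_trans (mxrankM_maxl _ _)) //.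
  by rewrite (leq_trans (rank_leq_col _)) ?card_ord.
have [f [_ /(_ (atomic_moments z w)) h]] := moment_mx_mxsub R (@monomialsS n).
rewrite -[moment_mx n beta](@moment_mx_on_eq _ n (2 * n) _ beta (atomic_moments z w)) //; last lia.
  by rewrite h mxsubE (leq_trans (mxrankM_maxl _ _)) // mxrankM_maxr.
by case=> i j; rewrite mem_monomials.
Qed.

(** By flatness the form takes moments of degree 2n + 2 as values. The recurrence for x^4 y^(2n-2)
    gives phi, that for x^3 y^(2n-1) gives psi, and Q vanishes because both of its terms are the
    moment of x^2 y^(2n). *)
Lemma flat_equations gamma : flat_extension n beta gamma ->
  [/\ cubic_recurrence a b (2 * n).+1 gamma,
      forall i j k l, (i + j <= n.+1)%N -> (k + l <= n.+1)%N ->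
        mform n gamma i j k l = gamma (i + k)%N (j + l)%N,
      gamma 1%N (2 * n)%N = phi_star n a b beta (gamma 2%N (2 * n - 1)%N),
      gamma 0%N (2 * n).+1 =
        psi_star n a b beta (gamma 2%N (2 * n - 1)%N) (gamma 1%N (2 * n)%N) &
      Rfun n a b beta (gamma 2%N (2 * n - 1)%N) = 0].
Proof.
move=> [e _ rk]; have Kg := posdef_ext e.
have flat i j k l : (i + j <= n.+1)%N -> (k + l <= n.+1)%N ->
    mform n gamma i j k l = gamma (i + k)%N (j + l)%N.
  by apply: flat_mform => //; rewrite rk rankM.
have rec0 : cubic_recurrence a b (2 * n) gamma.
  by move=> i j ij; rewrite !e ?rec //; lia.
have rec1 : cubic_recurrence a b (2 * n).+1 gamma.
  have -> : (2 * n).+1 = (n + n.+1)%N by lia.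
  by apply: (mform_recurrence n_gt0 Kg flat rec0); lia.
have rec2 : cubic_recurrence a b (n.+1 + n.+1) gamma.
  by apply: (mform_recurrence n_gt0 Kg flat rec1); lia.
have phiE : gamma 1%N (2 * n)%N = phi_star n a b beta (gamma 2%N (2 * n - 1)%N).
  rewrite (phi_starE n_gt1 e rec1 Kg) flat; try lia.
  have -> : (2 + 2 = 1.+3)%N by [].
  rewrite rec2; last lia.
  have -> : (n - 1 + (n - 1)).+2 = (2 * n)%N by lia.
  have -> : (n - 1 + (n - 1) = 2 * n - 2)%N by lia.
  by ring.
have psiE : gamma 0%N (2 * n).+1 =
        psi_star n a b beta (gamma 2%N (2 * n - 1)%N) (gamma 1%N (2 * n)%N).
  rewrite (psi_starE n_gt1 e rec1 Kg) flat; try lia.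
  have -> : (1 + 2 = 0.+3)%N by [].
  rewrite rec2; last lia.
  have -> : (n + (n - 1)).+2 = (2 * n).+1 by lia.
  have -> : (n + (n - 1) = 2 * n - 1)%N by lia.
  by ring.
split => //.
rewrite /Rfun -phiE -psiE (QfunE n_gt1 e rec1 Kg) !flat; try lia.
by apply/eqP; rewrite subr_eq0; apply/eqP; congr (gamma _ _); lia.
Qed.

Lemma root_measure theta : Rfun n a b beta theta = 0 ->
  exists (z : 'I_N -> R * R) (w : 'I_N -> R) (mu : plane_measure R),
  [/\ forall k, 0 < w k, atomic z w mu,
      forall i j, (i + j <= 2 * n)%N -> atomic_moments z w i j = beta i j,
      is_measure mu & atomic_moments z w 2 (2 * n - 1) = theta].
Proof.
rewrite /Rfun; set phi := phi_star _ _ _ _ _; set psi := psi_star _ _ _ _ _ _ => Q0.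
(* Only the values up to degree 2n + 1 are meaningful, and [quadrature] needs no others. *)
set gamma := extended_moments n a b beta theta phi psi.
have e i j : (i + j <= 2 * n)%N -> gamma i j = beta i j by rewrite /gamma /extended_moments => ->.
have Kg := posdef_ext e.
have rec1 : cubic_recurrence a b (2 * n).+1 gamma.
  move=> i j ij; have [ij2|ij2] := leqP (i.+3 + j) (2 * n).
    by rewrite !e ?rec //; lia.
  rewrite {1}/gamma /extended_moments leqNgt ij2 /= -!e //; lia.
have thE : gamma 2%N (2 * n - 1)%N = theta.
  by rewrite /gamma /extended_moments; case: leqP => //; lia.
have phE : gamma 1%N (2 * n)%N = phi.
  by rewrite /gamma /extended_moments; case: leqP => //; lia.
have psE : gamma 0%N (2 * n).+1 = psi.
  by rewrite /gamma /extended_moments; case: leqP => //; lia.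
have eq11 := phi_starE n_gt1 e rec1 Kg; rewrite thE -/phi -{1}phE in eq11.
have eq12 := psi_starE n_gt1 e rec1 Kg; rewrite thE phE -/psi -{1}psE in eq12.
have eq22 := QfunE n_gt1 e rec1 Kg; rewrite thE phE psE Q0 in eq22.
have [||| z [w [z_inj w_gt0 zp mom]]] := quadrature n_gt1 Kg rec1.
- by rewrite eq11; ring.
- by rewrite eq12; ring.
- by apply/eqP; rewrite -subr_eq0 -eq22.
pose w_ge0 k : 0 <= w k := ltW (w_gt0 k).
exists z, w, (atomic_measure z w_ge0); split => //.
- exact: atomic_measure_atomic.
- by move=> i j ij; rewrite -e // mom //; lia.
- split; last by rewrite rankM; exact: card_msupp_atomic_measure.
  split.
    rewrite msupp_atomic_measure // => _ [k _ <-]; rewrite /zero_locus /= /cubic.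
    rewrite !(hornerE, hornerXn, horner_exp) /= zp; ring.
  move=> i j ij; have [h1 h2] := moment_atomic w_ge0 i j (atomic_measure_atomic z w_ge0).
  split => //; rewrite h2 -e //; congr (_%:E); rewrite mom //; lia.
- by rewrite -thE mom //; lia.
Qed.

Lemma atomic_same_measure (z z' : 'I_N -> R * R) (w w' : 'I_N -> R) mu mu' :
    (forall k, 0 < w k) -> (forall k, 0 < w' k) ->
    (forall i j, (i + j <= 2 * n)%N -> atomic_moments z w i j = beta i j) ->
    (forall i j, (i + j <= 2 * n)%N -> atomic_moments z' w' i j = beta i j) ->
    atomic z w mu -> atomic z' w' mu' ->
    atomic_moments z w 2 (2 * n - 1) = atomic_moments z' w' 2 (2 * n - 1) ->
  same_measure mu mu'.
Proof.
move=> w0 w0' e e' muE muE' th A mA; rewrite muE // muE' //; congr (_%:E).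
apply: atomic_moments_inj => i j.
have [rec1 flat ph ps _] := flat_equations (atomic_flat w0 e).
have [rec1' flat' ph' ps' _] := flat_equations (atomic_flat w0' e').
have Kg := posdef_ext e; have Kg' := posdef_ext e'.
(* Equal theta forces equal phi and psi, so both sequences are the same extension of beta up to
   degree 2n + 1. *)
have eqm k l : (k + l <= (2 * n).+1)%N -> atomic_moments z w k l = atomic_moments z' w' k l.
  move=> kl; rewrite -(extended_momentsE n_gt1 e rec1 kl (t := atomic_moments z w 2 (2 * n - 1)) (f := atomic_moments z w 1 (2 * n)) (p := atomic_moments z w 0 (2 * n).+1)) //.
  by apply: (extended_momentsE n_gt1 e' rec1') => // _; rewrite ?ps ?ps' ph ph' th.
rewrite (atomic_momentsE n_gt0 w0 Kg flat rec1) (atomic_momentsE n_gt0 w0' Kg' flat' rec1').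
apply: eq_bigr => m _; rewrite eqm ?(iter_mvec_eq n_gt0 eqm) //.
by have := mon_basisB m n_gt0; lia.
Qed.

End Main.

(** * Roots of a real polynomial of degree at most two *)

Section QuadraticRoots.
Variables (R : rcfType) (q : {poly R}).
Hypothesis q_size : (size q <= 3)%N.
Let Delta := q`_1 ^+ 2 - 4 * q`_0 * q`_2.

Let horner_q t : q.[t] = q`_0 + q`_1 * t + q`_2 * t ^+ 2.
Proof.
by rewrite (horner_coef_wide _ q_size) !big_ord_recl big_ord0 /= expr0 expr1; ring.
Qed.

Let complete_square t : 4 * q`_2 * q.[t] = (2 * q`_2 * t + q`_1) ^+ 2 - Delta.
Proof. by rewrite horner_q /Delta; ring. Qed.

Let root_square t : q`_2 != 0 -> root q t = ((2 * q`_2 * t + q`_1) ^+ 2 == Delta).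
Proof.
move=> q2; rewrite rootE -[RHS]subr_eq0 -complete_square !mulf_eq0 (negbTE q2) orbF.
by rewrite pnatr_eq0.
Qed.

Lemma quadratic_root_uniq t u : q != 0 -> Delta = 0 -> root q t -> root q u -> t = u.
Proof.
move=> q0 D0; have [q2|q2] := eqVneq q`_2 0.
  move/eqP: (D0); rewrite /Delta q2 mulr0 subr0 sqrf_eq0 => /eqP q1.
  rewrite rootE horner_q q1 q2 !mul0r !addr0 => /eqP q00.
  case/eqP: q0; apply/polyP => -[|[|[|i]]]; rewrite ?coef0 //.
  by rewrite nth_default // (leq_trans q_size).
rewrite !root_square // D0 !sqrf_eq0 => /eqP ht /eqP hu.
have q22 : 2 * q`_2 != 0 by rewrite mulf_neq0 ?pnatr_eq0.
by apply: (mulfI q22); apply: (addIr q`_1); rewrite ht hu.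
Qed.

(** With zero leading coefficient a positive discriminant is the square of the slope and there is
    just one root; the first hypothesis excludes this. *)
Lemma quadratic_two_roots : q`_2 != 0 -> 0 < Delta ->
  exists t u, [/\ t != u, root q t, root q u &
    forall s, root q s -> s = t \/ s = u].
Proof.
move=> q2 D0; pose r := Num.sqrt Delta.
have r2 : r ^+ 2 = Delta by rewrite sqr_sqrtr // ltW.
have r0 : r != 0 by rewrite gt_eqF // sqrtr_gt0.
exists ((r - q`_1) / (2 * q`_2)), ((- r - q`_1) / (2 * q`_2)).
have q22 : 2 * q`_2 != 0 by rewrite mulf_neq0 ?pnatr_eq0.
have cancel s : 2 * q`_2 * ((s - q`_1) / (2 * q`_2)) + q`_1 = s by field.
split.
- apply: contra_neq r0 => e; have := cancel r; rewrite e cancel => rN.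
  by lra.
- by rewrite root_square // cancel r2.
- by rewrite root_square // cancel sqrrN r2.
move=> s; rewrite root_square // -r2 eqf_sqr => /orP[]/eqP <-; [left|right]; by field.
Qed.
End QuadraticRoots.

Theorem theorem3p2 (R : realType) (n : nat) (a b : R) (beta : nat -> nat -> R)
    (hn : (3 <= n)%N)
    (hpsd : psd (moment_mx n beta))
    (hpure : p_pure (cubic a b) n beta) :
  let is_measure :=
    atomic_representing_measure (\rank (moment_mx n beta)) (cubic a b) n beta in
  exists Rp : {poly R},
    [/\ (size Rp <= 3)%N,
        forall theta, Rp.[theta] = Rfun n a b beta theta,
        ((exists mu, is_measure mu) <->
           (exists beta', flat_extension n beta beta')) /\
        ((exists beta', flat_extension n beta beta') <->
           (exists theta, root Rp theta)) &
        Rp != 0 -> (exists theta, root Rp theta) ->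
        let Delta := Rp`_1 ^+ 2 - 4 * Rp`_0 * Rp`_2 in
        (Delta = 0 ->
           exists mu, is_measure mu /\
             forall nu, is_measure nu -> same_measure nu mu) /\
        (Rp`_2 != 0 -> 0 < Delta ->
           exists mu1 mu2,
             [/\ is_measure mu1, is_measure mu2, ~ same_measure mu1 mu2 &
                 forall nu, is_measure nu ->
                   same_measure nu mu1 \/ same_measure nu mu2])].
Proof.
move=> is_measure.
have [Rp [Rp_size RpE]] := Rfun_poly a b beta (ltnW hn).
have flat_root gamma : flat_extension n beta gamma -> exists t, root Rp t.
  move=> /(flat_equations hn hpsd hpure)[_ _ _ _ r0].
  by exists (gamma 2%N (2 * n - 1)%N); rewrite rootE RpE r0.
(* The moment of x^2 y^(2n-1) sets up a bijection between measures, up to [same_measure], and roots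
   of [Rp], so counting measures is counting roots. *)
pose theta_of mu t := exists (z : 'I_(size (basisB n)) -> R * R) w,
  [/\ forall k, 0 < w k, atomic z w mu,
      forall i j, (i + j <= 2 * n)%N -> atomic_moments z w i j = beta i j &
      atomic_moments z w 2 (2 * n - 1) = t].
have measure_theta mu : is_measure mu -> exists2 t, root Rp t & theta_of mu t.
  move=> /(measure_atomic hn hpsd hpure)[z [w [_ w0 muE e]]].
  have [_ _ _ _ r0] := flat_equations hn hpsd hpure (atomic_flat hn hpsd hpure w0 e).
  exists (atomic_moments z w 2 (2 * n - 1)); first by rewrite rootE RpE r0.
  by exists z, w.
have root_theta t : root Rp t -> exists2 mu, is_measure mu & theta_of mu t.
  rewrite rootE RpE => /eqP /(root_measure hn hpsd hpure)[z [w [mu [? ? ? ? ?]]]].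
  by exists mu => //; exists z, w.
have theta_same mu nu t : theta_of mu t -> theta_of nu t -> same_measure mu nu.
  move=> [z [w [w0 muE e <-]]] [z' [w' [w0' nuE e' th]]].
  exact: (atomic_same_measure hn hpsd hpure w0 w0' e e' muE nuE (esym th)).
have theta_uniq mu nu t s : theta_of mu t -> theta_of nu s -> same_measure mu nu -> t = s.
  move=> [z [w [w0 muE _ <-]]] [z' [w' [w0' nuE _ <-]]] same.
  have [_ h] := moment_atomic (fun k => ltW (w0 k)) 2 (2 * n - 1) muE.
  have [_ h'] := moment_atomic (fun k => ltW (w0' k)) 2 (2 * n - 1) nuE.
  have : (atomic_moments z w 2 (2 * n - 1))%:E = (atomic_moments z' w' 2 (2 * n - 1))%:E.
    by rewrite -h -h'; apply: eq_measure_integral => A mA _; exact: same.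
  by case.
exists Rp; split => //.
  split; split.
  - move=> [mu /(measure_atomic hn hpsd hpure)[z [w [_ w0 _ e]]]].
    by exists (atomic_moments z w); apply: (atomic_flat hn hpsd hpure).
  - by move=> [gamma /flat_root[t /root_theta[mu]]]; exists mu.
  - by move=> [gamma /flat_root].
  - move=> [t /root_theta[mu /(measure_atomic hn hpsd hpure)[z [w [_ w0 _ e]]] _]].
    by exists (atomic_moments z w); apply: (atomic_flat hn hpsd hpure).
move=> Rp0 [t rt] Delta; split=> [D0|Rp2 D0].
  have [mu mu_meas mu_t] := root_theta t rt; exists mu; split => // nu.
  move=> /measure_theta[s rs nu_s].
  by apply: theta_same nu_s _; rewrite (quadratic_root_uniq Rp_size Rp0 D0 rs rt).
have [t1 [t2 [t12 r1 r2 tP]]] := quadratic_two_roots Rp_size Rp2 D0.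
have [mu1 m1 mu1_t] := root_theta _ r1; have [mu2 m2 mu2_t] := root_theta _ r2.
exists mu1, mu2; split => //.
  by move=> /(theta_uniq _ _ _ _ mu1_t mu2_t)/eqP; rewrite (negbTE t12).
move=> nu /measure_theta[s /tP[->|->] nu_s]; [left|right].
  exact: theta_same nu_s mu1_t.
exact: theta_same nu_s mu2_t.
Qed.
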